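(* Let $K$ be a field and let $I\subset K[x_1,\ldots,x_n]$ be an equigenerated monomial ideal generated in degree $d$ with $\operatorname{height} I=n$. Then $I$ is Freiman if and only if $I^2=JI$, where $J=(x_1^d,\ldots,x_n^d)$. If these equivalent conditions hold, then the fiber cone $F(I)$ is Cohen--Macaulay.
   Context: $\mathfrak m=(x_1,\ldots,x_n)\subset S=K[x_1,\ldots,x_n]$. For a graded ideal $I\subset S$, $\mu(I)$ denotes the minimal number of generators of $I$; the fiber cone is $F(I)=\bigoplus_{k\ge 0} I^k/\mathfrak m I^k$, and the analytic spread $\ell(I)$ is the Krull dimension of $F(I)$. An ideal is equigenerated if all elements of a minimal set of generators have the same degree. An equigenerated monomial ideal $I$ is called Freiman if $\mu(I^2)=\ell(I)\mu(I)-\binom{\ell(I)}{2}$. *)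

(* Defs.v *)
From HB Require Import structures.
From mathcomp Require Import all_boot all_order all_algebra.
From mathcomp Require Import generic_quotient ring_quotient ring mpoly.
From mathcomp Require Import boolp classical_sets.

Set Implicit Arguments.
Unset Strict Implicit.
Unset Printing Implicit Defensive.

Import GRing.Theory.

Local Open Scope ring_scope.
Local Open Scope quotient_scope.
Local Open Scope classical_set_scope.

Section Ideals.
Variable A : comNzRingType.
Implicit Types (I J P Q : set A).

Definition is_ideal I : Prop :=
  [/\ I 0, forall x y, I x -> I y -> I (x + y) & forall a x, I x -> I (a * x)].

Definition ideal_gen (X : set A) : set A :=
  [set x | forall I, is_ideal I -> X `<=` I -> I x].

Definition ideal_mul I J : set A :=
  ideal_gen [set z | exists x y, [/\ I x, J y & z = x * y]].

Fixpoint ideal_pow I (k : nat) : set A :=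
  if k is k'.+1 then ideal_mul I (ideal_pow I k') else setT.

Definition is_prime P : Prop :=
  [/\ is_ideal P, ~ P 1 & forall x y, P (x * y) -> P x \/ P y].

Definition is_maximal P : Prop :=
  [/\ is_ideal P, ~ P 1 &
      forall Q, is_ideal Q -> ~ Q 1 -> P `<=` Q -> Q = P].

Definition is_noetherian : Prop :=
  forall I, is_ideal I -> exists s : seq A, I = ideal_gen [set` s].

(* [k] is the supremum, finite and therefore attained, of [X] *)
Definition is_max (X : set nat) (k : nat) : Prop :=
  X k /\ forall j, X j -> (j <= k)%N.

(* P 0 < P 1 < ... < P k; the values of [P] beyond [k] are irrelevant *)
Definition prime_chain (P : nat -> set A) (k : nat) : Prop :=
  (forall i, (i <= k)%N -> is_prime (P i)) /\
  (forall i, (i < k)%N -> P i `<` P i.+1).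

Definition krull_dim (k : nat) : Prop :=
  is_max [set r | exists P : nat -> set A, prime_chain P r] k.

Definition prime_height Q (k : nat) : Prop :=
  is_max [set r | exists P : nat -> set A, prime_chain P r /\ P r = Q] k.

(* The unit ideal has no height (it is conventionally infinite), and primes of
   infinite height do not contribute to the infimum. *)
Definition height I (k : nat) : Prop :=
  (exists P, [/\ is_prime P, I `<=` P & prime_height P k]) /\
  (forall P h, is_prime P -> I `<=` P -> prime_height P h -> (k <= h)%N).

(* [mu I m] : the minimal number of generators of [I] is [m] *)
Definition mu I (m : nat) : Prop :=
  (exists s : seq A, size s = m /\ I = ideal_gen [set` s]) /\
  (forall s : seq A, I = ideal_gen [set` s] -> (m <= size s)%N).

Definition minimal_generators I (s : seq A) : Prop :=
  I = ideal_gen [set` s] /\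
  (forall s' : seq A, {subset s' <= s} -> I = ideal_gen [set` s'] ->
     {subset s <= s'}).

Definition regular_sequence (s : seq A) : Prop :=
  (forall i, (i < size s)%N -> forall x,
     ideal_gen [set` take i s] (s`_i * x) -> ideal_gen [set` take i s] x) /\
  ideal_gen [set` s] <> setT.

Definition nonunits : set A := [set x | ~ exists y, x * y = 1].

(* the depth with respect to the maximal ideal, when [A] is local Noetherian *)
Definition local_depth (k : nat) : Prop :=
  is_max [set r | exists s : seq A,
            [/\ size s = r, [set` s] `<=` nonunits & regular_sequence s]] k.

End Ideals.

Arguments is_noetherian : clear implicits.
Arguments krull_dim : clear implicits.
Arguments local_depth : clear implicits.

Section IdealLemmas.
Variable A : comNzRingType.
Implicit Types (I J P : set A).

Lemma ideal_gen_is_ideal (X : set A) : is_ideal (ideal_gen X).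
Proof.
split=> [I [] //|x y hx hy I hI hX|a x hx I hI hX].
  by case: (hI) => _ hD _; apply: hD; [apply: hx|apply: hy].
by case: (hI) => _ _ hM; apply: hM; apply: hx.
Qed.

Lemma ideal_gen_sub (X : set A) : X `<=` ideal_gen X.
Proof. by move=> x Xx I _; apply. Qed.

Lemma ideal_pow_is_ideal I k : is_ideal (ideal_pow I k).
Proof. by case: k => [|k]; [split|apply: ideal_gen_is_ideal]. Qed.

Lemma ideal_mul_mem I J x y : I x -> J y -> ideal_mul I J (x * y).
Proof. by move=> Ix Jy; apply: ideal_gen_sub; exists x, y. Qed.

Lemma ideal_mul_bilin I J (L : set A) y : is_ideal L ->
  (forall a b, I a -> J b -> L (a * b * y)) ->
  forall x, ideal_mul I J x -> L (x * y).
Proof.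
move=> [L0 LD LM] h x /(_ [set z | L (z * y)]); apply.
  split=> /= [|u v|a u]; first by rewrite mul0r.
    by rewrite mulrDl; apply: LD.
  by rewrite -mulrA; apply: LM.
by move=> z [a [b [Ia Jb ->]]]; apply: h.
Qed.

Lemma ideal_pow_mul I k l x y :
  ideal_pow I k x -> ideal_pow I l y -> ideal_pow I (k + l) (x * y).
Proof.
elim: k x y => [|k IH] x y /=.
  by move=> _; case: (ideal_pow_is_ideal I l) => _ _; apply.
move=> hx hy; apply: ideal_mul_bilin hx; first exact: ideal_gen_is_ideal.
by move=> a b Ia hb; rewrite -mulrA; apply: ideal_mul_mem => //; apply: IH.
Qed.

Lemma ideal_sum (L : set A) (n : nat) (F : 'I_n -> A) :
  is_ideal L -> (forall i, L (F i)) -> L (\sum_i F i).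
Proof. by move=> [L0 LD _] h; elim/big_ind: _. Qed.

Lemma ideal_opp (L : set A) x : is_ideal L -> L x -> L (- x).
Proof. by move=> [_ _ LM] Lx; rewrite -mulN1r; apply: LM. Qed.

End IdealLemmas.

Section Localization.
Variables (A : comNzRingType) (P : set A) (P_prime : is_prime P).

Lemma prime_denom1 : ~ P 1. Proof. by case: P_prime. Qed.

Lemma prime_denomM x y : ~ P x -> ~ P y -> ~ P (x * y).
Proof. by case: P_prime => _ _ h hx hy /h []. Qed.

Inductive loc_frac := LocFrac { loc_pair :> A * A; _ : `[< ~ P loc_pair.2 >] }.

HB.instance Definition _ := [isSub for loc_pair].
HB.instance Definition _ := [Choice of loc_frac by <:].

Definition mk_frac (a s : A) (hs : ~ P s) : loc_frac :=
  @LocFrac (a, s) (asboolT hs).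

Lemma loc_denomP (x : loc_frac) : ~ P x.2.
Proof. by case: x => x hx; apply/asboolP. Qed.
Arguments loc_denomP : clear implicits.

Definition loc_equiv (x y : loc_frac) : bool :=
  `[< exists u, ~ P u /\ u * (x.1 * y.2) = u * (y.1 * x.2) >].

Lemma loc_equiv_refl : reflexive loc_equiv.
Proof. by move=> x; apply/asboolP; exists 1; split=> //; apply: prime_denom1. Qed.

Lemma loc_equiv_sym : ssrbool.symmetric loc_equiv.
Proof.
by move=> x y; apply/asboolP/asboolP => -[u [hu e]]; exists u; split=> //;
  rewrite e.
Qed.

Lemma loc_equiv_trans : transitive loc_equiv.
Proof.
move=> y x z /asboolP[u [hu e]] /asboolP[v [hv f]]; apply/asboolP.
exists (u * v * y.2); split.
  exact: prime_denomM (prime_denomM hu hv) (loc_denomP y).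
transitivity (v * z.2 * (u * (x.1 * y.2))); first by ring.
rewrite e; transitivity (u * x.2 * (v * (y.1 * z.2))); first by ring.
by rewrite f; ring.
Qed.

Canonical loc_equivRel :=
  EquivRel loc_equiv loc_equiv_refl loc_equiv_sym loc_equiv_trans.

Definition localization := {eq_quot loc_equivRel}.

HB.instance Definition _ := EqQuotient.on localization.
HB.instance Definition _ := Choice.on localization.

Local Notation L := localization.

Definition mk_loc (a s : A) (hs : ~ P s) : L := \pi_L (mk_frac a hs).

Lemma mk_locE a s hs b t ht :
  @mk_loc a s hs = @mk_loc b t ht <->
  exists u, ~ P u /\ u * (a * t) = u * (b * s).
Proof.
split=> [/eqP|h].
  by rewrite /mk_loc eqmodE /= => /asboolP.
by apply/eqP; rewrite /mk_loc eqmodE /=; apply/asboolP.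
Qed.

Lemma mk_loc_repr (x : L) : mk_loc (repr x).1 (loc_denomP (repr x)) = x.
Proof.
rewrite -[RHS]reprK /mk_loc; congr (\pi _).
by apply: val_inj => /=; case: (val (repr x)).
Qed.

Lemma mk_loc_surj (x : L) : exists a s hs, x = @mk_loc a s hs.
Proof.
by exists (repr x).1, (repr x).2, (loc_denomP (repr x)); rewrite mk_loc_repr.
Qed.

Definition loc_add (x y : L) : L :=
  let: (a, b) := (repr x, repr y) in
  mk_loc (a.1 * b.2 + b.1 * a.2) (prime_denomM (loc_denomP a) (loc_denomP b)).
Definition loc_opp (x : L) : L := mk_loc (- (repr x).1) (loc_denomP (repr x)).
Definition loc_mul (x y : L) : L :=
  let: (a, b) := (repr x, repr y) in
  mk_loc (a.1 * b.1) (prime_denomM (loc_denomP a) (loc_denomP b)).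
Definition loc_zero : L := mk_loc 0 prime_denom1.
Definition loc_one : L := mk_loc 1 prime_denom1.

Lemma repr_mk_loc a s hs : exists u, ~ P u /\
  u * ((repr (@mk_loc a s hs)).1 * s) = u * (a * (repr (@mk_loc a s hs)).2).
Proof.
by apply/(@mk_locE _ _ (loc_denomP _) _ _ hs); rewrite mk_loc_repr.
Qed.

Lemma loc_addE a s hs b t ht : loc_add (@mk_loc a s hs) (@mk_loc b t ht) =
  mk_loc (a * t + b * s) (prime_denomM hs ht).
Proof.
have [u [hu e]] := repr_mk_loc a hs; have [v [hv f]] := repr_mk_loc b ht.
apply/mk_locE.
move: (repr (mk_loc a hs)) (repr (mk_loc b ht)) e f => x y e f.
exists (u * v); split; first exact: prime_denomM.
transitivity (v * y.2 * t * (u * (x.1 * s)) + u * x.2 * s * (v * (y.1 * t))).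
  by ring.
by rewrite e f; ring.
Qed.

Lemma loc_mulE a s hs b t ht : loc_mul (@mk_loc a s hs) (@mk_loc b t ht) =
  mk_loc (a * b) (prime_denomM hs ht).
Proof.
have [u [hu e]] := repr_mk_loc a hs; have [v [hv f]] := repr_mk_loc b ht.
apply/mk_locE.
move: (repr (mk_loc a hs)) (repr (mk_loc b ht)) e f => x y e f.
exists (u * v); split; first exact: prime_denomM.
transitivity ((u * (x.1 * s)) * (v * (y.1 * t))); first by ring.
by rewrite e f; ring.
Qed.

Lemma loc_oppE a s hs : loc_opp (@mk_loc a s hs) = mk_loc (- a) hs.
Proof.
have [u [hu e]] := repr_mk_loc a hs.
apply/mk_locE; move: e; move: (repr _) => x e.
by exists u; split=> //; rewrite !mulNr !mulrN e.
Qed.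

Let mk_loc_eq a s hs b t ht : a * t = b * s -> @mk_loc a s hs = @mk_loc b t ht.
Proof.
move=> e; apply/mk_locE; exists 1; split; first exact: prime_denom1.
by rewrite e.
Qed.

Lemma loc_addA : associative loc_add.
Proof.
move=> x y z; have [a [s [hs ->]]] := mk_loc_surj x.
have [b [t [ht ->]]] := mk_loc_surj y; have [c [r [hr ->]]] := mk_loc_surj z.
by rewrite !loc_addE; apply: mk_loc_eq; ring.
Qed.

Lemma loc_addC : commutative loc_add.
Proof.
move=> x y; have [a [s [hs ->]]] := mk_loc_surj x.
have [b [t [ht ->]]] := mk_loc_surj y.
by rewrite !loc_addE; apply: mk_loc_eq; ring.
Qed.

Lemma loc_add0 : left_id loc_zero loc_add.
Proof.
move=> x; have [a [s [hs ->]]] := mk_loc_surj x.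
by rewrite loc_addE; apply: mk_loc_eq; ring.
Qed.

Lemma loc_addN : left_inverse loc_zero loc_opp loc_add.
Proof.
move=> x; have [a [s [hs ->]]] := mk_loc_surj x.
by rewrite loc_oppE loc_addE; apply: mk_loc_eq; ring.
Qed.

Lemma loc_mulA : associative loc_mul.
Proof.
move=> x y z; have [a [s [hs ->]]] := mk_loc_surj x.
have [b [t [ht ->]]] := mk_loc_surj y; have [c [r [hr ->]]] := mk_loc_surj z.
by rewrite !loc_mulE; apply: mk_loc_eq; ring.
Qed.

Lemma loc_mulC : commutative loc_mul.
Proof.
move=> x y; have [a [s [hs ->]]] := mk_loc_surj x.
have [b [t [ht ->]]] := mk_loc_surj y.
by rewrite !loc_mulE; apply: mk_loc_eq; ring.
Qed.

Lemma loc_mul1 : left_id loc_one loc_mul.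
Proof.
move=> x; have [a [s [hs ->]]] := mk_loc_surj x.
by rewrite loc_mulE; apply: mk_loc_eq; ring.
Qed.

Lemma loc_mulDl : left_distributive loc_mul loc_add.
Proof.
move=> x y z; have [a [s [hs ->]]] := mk_loc_surj x.
have [b [t [ht ->]]] := mk_loc_surj y; have [c [r [hr ->]]] := mk_loc_surj z.
by rewrite !(loc_mulE, loc_addE); apply: mk_loc_eq; ring.
Qed.

Lemma loc_one_neq0 : loc_one != loc_zero.
Proof.
apply/eqP => /mk_locE [u [hu]]; rewrite mul0r !mulr1 mulr0 => u0.
by apply: hu; rewrite u0; case: P_prime => -[].
Qed.

HB.instance Definition _ :=
  GRing.isZmodule.Build localization loc_addA loc_addC loc_add0 loc_addN.
HB.instance Definition _ :=
  GRing.Zmodule_isComNzRing.Build localization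
    loc_mulA loc_mulC loc_mul1 loc_mulDl loc_one_neq0.

End Localization.

(* Noetherian, and depth = dim in the localization at every maximal ideal *)
Definition cohen_macaulay (A : comNzRingType) : Prop :=
  is_noetherian A /\
  forall (P : set A) (P_prime : is_prime P), is_maximal P ->
    exists k, krull_dim (localization P_prime) k /\
              local_depth (localization P_prime) k.

Section FiberCone.
Variables (K : fieldType) (n : nat).
Local Notation S := {mpoly K[n]}.
Implicit Types I : set S.

Definition monomial_ideal I : Prop :=
  exists M : set 'X_{1..n}, I = ideal_gen [set ('X_[a] : S) | a in M].

Definition equigenerated I (d : nat) : Prop :=
  exists s : seq S, minimal_generators I s /\ {in s, forall f, f \is d.-homog}.

Definition max_ideal : set S := ideal_gen [set ('X_i : S) | i in [set: 'I_n]].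

Variable I : set S.

Definition rees_pred : {pred {poly S}} :=
  fun f => `[< forall k, ideal_pow I k f`_k >].

Lemma rees_subring : subring_closed rees_pred.
Proof.
split=> [|f g /asboolP hf /asboolP hg|f g /asboolP hf /asboolP hg];
  apply/asboolP => k.
- rewrite coef1; case: k => [|k] //=.
  by case: (ideal_gen_is_ideal
    [set z | exists x y, [/\ I x, ideal_pow I k y & z = x * y]]).
- rewrite coefB; have hI := ideal_pow_is_ideal I k.
  by case: (hI) => _ hD _; apply: hD => //; apply: ideal_opp.
- rewrite coefM; apply: ideal_sum; first exact: ideal_pow_is_ideal.
  move=> i; have le_ik : (i <= k)%N by rewrite -ltnS.
  by have := ideal_pow_mul (hf i) (hg (k - i)%N); rewrite subnKC.
Qed.

HB.instance Definition _ :=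
  GRing.isSubringClosed.Build {poly S} rees_pred rees_subring.

(* The Rees algebra: the direct sum of the I^k is realised as the subring of
   S[t] of the polynomials whose coefficient of t^k lies in I^k. *)
Record rees := Rees { rees_val :> {poly S}; _ : rees_val \in rees_pred }.

HB.instance Definition _ := [isSub for rees_val].
HB.instance Definition _ := [Choice of rees by <:].
HB.instance Definition _ := [SubChoice_isSubComNzRing of rees by <:].

(* the direct sum of the m I^k *)
Definition fiber_ideal : {pred rees} :=
  fun f => `[< forall k, ideal_mul max_ideal (ideal_pow I k) (rees_val f)`_k >].

Lemma max_ideal_eval0 (f : S) : max_ideal f -> f.@[fun=> 0] = 0.
Proof.
move=> /(_ [set g : S | g.@[fun=> 0] = 0]); apply.
  split=> /= [|g h|a g]; first by rewrite meval0.
    by rewrite mevalD => -> ->; rewrite addr0.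
  by rewrite mevalM => ->; rewrite mulr0.
by move=> _ [i _ <-] /=; rewrite mevalXU.
Qed.

Lemma fiber_ideal_closed : idealr_closed fiber_ideal.
Proof.
have hid k := ideal_gen_is_ideal
  [set z | exists x y, [/\ max_ideal x, ideal_pow I k y & z = x * y]].
split.
- by apply/asboolP => k; rewrite coef0; case: (hid k).
- apply/asboolP => h; have {h} := h 0%N; rewrite /= coef1 /= => h.
  suff /max_ideal_eval0/eqP : max_ideal 1 by rewrite meval1 oner_eq0.
  rewrite -[1]mulr1; apply: ideal_mul_bilin h; first exact: ideal_gen_is_ideal.
  move=> x y mx _; rewrite mulr1 mulrC.
  case: (ideal_gen_is_ideal [set ('X_i : S) | i in [set: 'I_n]]) => _ _ hM.
  exact: hM.
- move=> a u v /asboolP hu /asboolP hv; apply/asboolP => k.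
  rewrite coefD; case: (hid k) => _ hD _; apply: hD; last exact: hv.
  rewrite coefM; apply: ideal_sum; first exact: hid.
  move=> i; rewrite mulrC.
  apply: ideal_mul_bilin (hu _); first exact: hid.
  move=> x y mx hy; rewrite -mulrA; apply: ideal_mul_mem => //.
  have le_ik : (i <= k)%N by rewrite -ltnS.
  have ha : ideal_pow I i (rees_val a)`_i.
    by case: a => a ha /=; move: ha => /asboolP; apply.
  by have := ideal_pow_mul hy ha; rewrite subnK.
Qed.

HB.instance Definition _ := isIdealr.Build rees fiber_ideal fiber_ideal_closed.

Definition fiber_cone : comNzRingType := {ideal_quot fiber_ideal}.

Definition analytic_spread (l : nat) : Prop := krull_dim fiber_cone l.

Definition freiman : Prop :=
  exists m m2 l : nat,
    [/\ mu I m, mu (ideal_pow I 2) m2, analytic_spread l &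
        m2%:Z = l%:Z * m%:Z - 'C(l, 2)%:Z].

End FiberCone.

(* Main.v *)
From HB Require Import structures.
Require Import Defs.
From mathcomp Require Import all_boot all_order all_algebra.
From mathcomp Require Import generic_quotient ring_quotient ring zify mpoly.
From mathcomp Require Import boolp classical_sets.
Set Implicit Arguments.
Unset Strict Implicit.
Unset Printing Implicit Defensive.
Import GRing.Theory.
Local Open Scope ring_scope.
Local Open Scope quotient_scope.
Local Open Scope classical_set_scope.

(** Let [s] be the list of the monomials of degree [d] in [I], so that [I] is
    generated by [s] and, as its height is [n], [s] contains the pure powers
    [x_i^d]: otherwise [I] would lie in the prime generated by the other
    variables, which has height less than [n] ([height_pure_power]).

    Projecting the coefficient of [t^k] in the Rees algebra onto its part of
    degree [k * d] identifies the fiber cone with the subalgebra of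
    [K[x_1..x_n]] spanned by the monoid generated by [s]
    ([fiber_cone_embedding]). Any [n + 1] elements of a polynomial ring in [n]
    variables are algebraically dependent ([mpoly_dependent]), which forbids
    chains of more than [n + 1] primes in the fiber cone, and the pure powers
    separate the traces of the coordinate primes; so the analytic spread is [n]
    ([fiber_cone_dim]).

    For ideals generated by monomials of one degree, numbers of generators are
    numbers of monomials ([mu_monideal]), so [mu (I^2)] counts the sums
    [a + b] of exponents of [s]. The sums [d * e_i + b] are the generators of
    [J I]; they are among the former and there are [n * size s - 'C(n, 2)] of
    them, because [d * e_i + a = d * e_j + b] with [i <> j] forces
    [a = d * e_j] and [b = d * e_i] ([size_pure_sums]). Hence [I] is Freiman
    exactly when all the generators of [I^2] belong to [J I]
    ([freiman_iff_reduction]).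

    Suppose that [I^2 = J I]. Then a monomial belongs to the fiber cone as soon
    as its product with a pure power does ([powers_cancel]). Dropping the
    monomials outside the fiber cone is therefore a retraction of
    [K[x_1..x_n]] that is linear over [B = K[x_1^d..x_n^d]], and sequences in
    [B] that are regular on the polynomial ring are regular on the fiber cone
    ([pure_power_regular]). By Zariski's lemma a maximal ideal contains a monic
    polynomial [g_i(x_i^d)] for each [i]; being polynomials in separate
    variables, the [g_i(x_i^d)] form a regular sequence ([univariate_regular]).
    So every localization at a maximal ideal has depth at least [n], while its
    dimension is at most [n]. Since regular sequences yield chains of primes of
    the same length ([regular_sequence_chain]), depth and dimension are both
    equal to [n]. *)

(** * Ideals, prime ideals and localizations *)

Section Ideals.
Variable A : comNzRingType.
Implicit Types (I J P Q : set A) (s : seq A).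

Lemma idealM I (hI : is_ideal I) a x : I x -> I (a * x).
Proof. by case: hI => _ _; apply. Qed.

Lemma idealD I x y : is_ideal I -> I x -> I y -> I (x + y).
Proof. by case=> _ h _; apply: h. Qed.

Lemma idealB I x y : is_ideal I -> I x -> I y -> I (x - y).
Proof. by move=> h Ix Iy; apply: idealD => //; apply: ideal_opp. Qed.

Lemma ideal0 I : is_ideal I -> I 0.
Proof. by case. Qed.

Lemma ideal_bigsum I (T : eqType) (r : seq T) (F : T -> A) :
  is_ideal I -> (forall i, i \in r -> I (F i)) -> I (\sum_(i <- r) F i).
Proof.
move=> hI h; rewrite big_seq; elim/big_ind: _ => [|x y|i /h //].
  exact: ideal0.
exact: idealD.
Qed.

Lemma ideal_gen_min (X I : set A) : is_ideal I -> X `<=` I -> ideal_gen X `<=` I.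
Proof. by move=> hI XI x; apply. Qed.

Lemma ideal_gen_sumP s x : ideal_gen [set` s] x ->
  exists c : nat -> A, x = \sum_(i < size s) c i * s`_i.
Proof.
pose Q : set A := [set x | exists c : nat -> A, x = \sum_(i < size s) c i * s`_i].
move=> h; suff : Q x by []; apply: h.
  split=> [|_ _ [c ->] [c' ->]|a _ [c ->]].
  - by exists (fun=> 0); rewrite big1 // => i _; rewrite mul0r.
  - exists (fun i => c i + c' i); rewrite -big_split /=.
    by apply: eq_bigr => i _; rewrite mulrDl.
  - exists (fun i => a * c i); rewrite mulr_sumr.
    by apply: eq_bigr => i _; rewrite mulrA.
move=> y /= ys; exists (fun i => (i == index y s)%:R).
have hi : (index y s < size s)%N by rewrite index_mem.
rewrite (bigD1 (Ordinal hi)) //= eqxx mul1r nth_index // big1 ?addr0 // => i.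
by rewrite -val_eqE /= => /negbTE ->; rewrite mul0r.
Qed.

Lemma ideal_gen_sum s (c : nat -> A) :
  ideal_gen [set` s] (\sum_(i < size s) c i * s`_i).
Proof.
apply: ideal_sum; first exact: ideal_gen_is_ideal.
move=> i; apply: (idealM (ideal_gen_is_ideal _)).
by apply: ideal_gen_sub => /=; apply: mem_nth.
Qed.

(** Krull's theorem: an ideal maximal among those that avoid [M] is prime. The
    empty set is admitted in the inductive family only so that the empty chain
    has a union in it. *)
Lemma exists_prime I (M : set A) : is_ideal I -> M 1 ->
    (forall x y, M x -> M y -> M (x * y)) -> (forall x, I x -> ~ M x) ->
  exists Q, [/\ is_prime Q, I `<=` Q & forall x, Q x -> ~ M x].
Proof.
move=> hI M1 MM IM.
pose good X := [/\ is_ideal X, I `<=` X & forall x, X x -> ~ M x].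
pose P : set (set A) := [set X | X = set0 \/ good X].
have [F FP tF|Q [[Q0|[hQ IQ QM]] Qmax]] := @Zorn_bigcup _ P.
- have [[X [FX gX]]|noX] := pselect (exists X, F X /\ good X); last first.
    left; apply/seteqP; split=> // x [X FX Xx]; exfalso.
    have [X0|gX] := FP _ FX; first by rewrite X0 in Xx.
    by apply: noX; exists X.
  right; split.
  + split=> [|x y [Y FY Yx] [Z FZ Zy]|a x [Y FY Yx]].
    * by exists X => //; case: gX => /ideal0.
    * have [Y0|[hY _ _]] := FP _ FY; first by rewrite Y0 in Yx.
      have [Z0|[hZ _ _]] := FP _ FZ; first by rewrite Z0 in Zy.
      have [YZ|ZY] := tF _ _ FY FZ.
        by exists Z => //; apply: idealD => //; apply: YZ.
      by exists Y => //; apply: idealD => //; apply: ZY.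
    * have [Y0|[hY _ _]] := FP _ FY; first by rewrite Y0 in Yx.
      by exists Y => //; apply: idealM.
  + by move=> x Ix; exists X => //; case: gX => _ IX _; apply: IX.
  + move=> x [Y FY Yx]; have [Y0|[_ _ YM]] := FP _ FY; last exact: YM.
    by rewrite Y0 in Yx.
- exfalso; apply: (Qmax I); last by right; split.
  rewrite Q0; split=> // /(_ 0); rewrite /set0 /=; apply; exact: ideal0.
exists Q; split=> //; split=> //; first by move=> Q1; apply: (QM 1).
move=> x y Qxy; have [Qx|nQx] := pselect (Q x); first by left.
have [Qy|nQy] := pselect (Q y); first by right.
exfalso.
have meet z : ~ Q z -> exists q a, Q q /\ M (q + a * z).
  move=> nQz; apply: contrapT => h.
  pose Qz : set A := [set w | exists q a, Q q /\ w = q + a * z].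
  apply: (Qmax Qz); first split.
  - by move=> q Qq; exists q, 0; rewrite mul0r addr0.
  - move=> /(_ z) hz; apply: nQz; apply: hz; exists 0, 1.
    by rewrite mul1r add0r; split=> //; apply: ideal0.
  - right; split.
    + split=> [|_ _ [q [a [Qq ->]]] [q' [a' [Qq' ->]]]|b _ [q [a [Qq ->]]]].
      * by exists 0, 0; rewrite mul0r addr0; split=> //; apply: ideal0.
      * exists (q + q'), (a + a'); split; first exact: idealD.
        by rewrite mulrDl addrACA.
      * exists (b * q), (b * a); split; first exact: idealM.
        by rewrite mulrDr mulrA.
    + by move=> w Iw; exists w, 0; rewrite mul0r addr0; split=> //; apply: IQ.
    + by move=> _ [q [a [Qq ->]]] Mw; apply: h; exists q, a.
have [q [a [Qq Mq]]] := meet _ nQx; have [r [b [Qr Mr]]] := meet _ nQy.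
apply: QM (MM _ _ Mq Mr).
have -> : (q + a * x) * (r + b * y) =
  r * q + (b * y) * q + (a * x) * r + (a * b) * (x * y) by ring.
by do ?apply: idealD => //; apply: idealM.
Qed.

Definition chain_cons Q (P : nat -> set A) : nat -> set A :=
  fun i => if i is j.+1 then P j else Q.

Lemma prime_chain_cons Q (P : nat -> set A) k :
  is_prime Q -> Q `<` P 0%N -> prime_chain P k ->
  prime_chain (chain_cons Q P) k.+1.
Proof.
move=> pQ QP [pP sP]; split; first by case.
by case=> [|i] //= ik; apply: sP.
Qed.

(** A nonzerodivisor [s_i] modulo [I = (s_0 .. s_(i-1))] lies outside some
    prime between [I] and a given prime [Q] over [I]: the multiplicative set of the
    [t * s_i ^+ k] with [t] outside [Q] does not meet [I]. So a regular
    sequence can be peeled off, each time with a strictly smaller prime. *)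
Lemma regular_sequence_chain s : regular_sequence s ->
  exists P : nat -> set A, prime_chain P (size s).
Proof.
case=> reg proper.
have id_s i := ideal_gen_is_ideal [set` take i s].
suff h k : (k <= size s)%N -> exists P : nat -> set A, prime_chain P k /\
    ideal_gen [set` take (size s - k) s] `<=` P 0%N.
  by have [|P [? _]] := h (size s); last exists P.
elim: k => [_|k IHk lt_ks].
  have [|||x hx x1|Q [pQ sQ _]] :=
    @exists_prime (ideal_gen [set` s]) [set x | x = 1].
  - exact: ideal_gen_is_ideal.
  - by [].
  - by move=> x y -> ->; rewrite mulr1.
  - apply: proper; apply/seteqP; split=> // y _; rewrite -[y]mulr1.
    by apply: (idealM (ideal_gen_is_ideal _)); rewrite -x1.
  - by exists (fun=> Q); rewrite subn0 take_size.
have [P [cP sP]] := IHk (ltnW lt_ks).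
pose j := (size s - k.+1)%N.
have jE : (size s - k = j.+1)%N by rewrite /j; lia.
have ltj : (j < size s)%N by rewrite /j; lia.
have [idP P1 PM] : is_prime (P 0%N) by apply: cP.1.
have Psj : P 0%N s`_j.
  apply: sP; apply: ideal_gen_sub => /=; rewrite jE (take_nth 0) //.
  by rewrite mem_rcons inE eqxx.
have P0sub : ideal_gen [set` take j s] `<=` P 0%N.
  apply: subset_trans sP; apply: ideal_gen_min; first exact: ideal_gen_is_ideal.
  move=> x /= xj; apply: ideal_gen_sub => /=.
  by rewrite jE (take_nth 0) // mem_rcons inE xj orbT.
pose M : set A := [set x | exists t e, ~ P 0%N t /\ x = t * s`_j ^+ e].
have [|||x Ix [t [e [Pt xE]]]|Q [pQ sQ QM]] :=
  @exists_prime (ideal_gen [set` take j s]) M.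
- exact: ideal_gen_is_ideal.
- by exists 1, 0%N; rewrite expr0 mulr1.
- move=> _ _ [t [e [Pt ->]]] [t' [e' [Pt' ->]]].
  exists (t * t'), (e + e')%N; rewrite exprD; split; last by ring.
  by move=> /PM [].
- apply: Pt; apply: P0sub; rewrite {x}xE in Ix.
  elim: e Ix => [|e IHe]; first by rewrite mulr1.
  by rewrite exprS mulrCA => /(reg _ ltj) /IHe.
exists (chain_cons Q P); split=> //; apply: prime_chain_cons => //; split.
  move=> x Qx; apply: contrapT => Px; apply: (QM x) => //.
  by exists x, 0%N; rewrite mulr1.
move=> /(_ _ Psj) Qsj; apply: (QM _ Qsj).
by exists 1, 1%N; rewrite mul1r expr1.
Qed.

Lemma is_max_unique (X : set nat) k l : is_max X k -> is_max X l -> k = l.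
Proof. by case=> Xk hk [Xl hl]; apply/eqP; rewrite eqn_leq hl // hk. Qed.

Lemma is_max_exists (X : set nat) b : (exists k, X k) ->
  (forall k, X k -> (k <= b)%N) -> exists2 k, is_max X k & (k <= b)%N.
Proof.
move=> [k Xk] hb; have [k0 /asboolP X0 max0] := @ex_maxnP (fun i => `[< X i >])
  b (ex_intro _ k (asboolT Xk)) (fun i Xi => hb i (asboolW Xi)).
by exists k0; [split=> // j Xj; apply: max0; apply/asboolP|apply: hb].
Qed.

End Ideals.

Section Localization.
Variables (A : comNzRingType) (P : set A) (P_prime : is_prime P).
Local Notation L := (localization P_prime).

Definition loc_of (a : A) : L := mk_loc P_prime a (prime_denom1 P_prime).

Lemma mk_locD a s hs b t ht : @mk_loc _ _ P_prime a s hs +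
  @mk_loc _ _ P_prime b t ht = mk_loc P_prime (a * t + b * s)
    (prime_denomM P_prime hs ht).
Proof. exact: loc_addE. Qed.

Lemma mk_locM a s hs b t ht : @mk_loc _ _ P_prime a s hs *
  @mk_loc _ _ P_prime b t ht = mk_loc P_prime (a * b)
    (prime_denomM P_prime hs ht).
Proof. exact: loc_mulE. Qed.

Lemma mk_loc_eq a s hs b t ht : a * t = b * s ->
  @mk_loc _ _ P_prime a s hs = @mk_loc _ _ P_prime b t ht.
Proof.
move=> e; apply/mk_locE; exists 1; split; first exact: prime_denom1.
by rewrite e.
Qed.

Lemma loc_of0 : loc_of 0 = 0. Proof. by []. Qed.
Lemma loc_of1 : loc_of 1 = 1. Proof. by []. Qed.

Lemma loc_ofD a b : loc_of (a + b) = loc_of a + loc_of b.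
Proof. by rewrite mk_locD; apply: mk_loc_eq; rewrite !mulr1. Qed.

Lemma loc_ofM a b : loc_of (a * b) = loc_of a * loc_of b.
Proof. by rewrite mk_locM; apply: mk_loc_eq; rewrite !mulr1. Qed.

Lemma mk_loc_den a s hs : @mk_loc _ _ P_prime a s hs = mk_loc P_prime 1 hs * loc_of a.
Proof. by rewrite mk_locM; apply: mk_loc_eq; ring. Qed.

Lemma loc_of_num a s hs : loc_of a = loc_of s * @mk_loc _ _ P_prime a s hs.
Proof. by rewrite mk_locM; apply: mk_loc_eq; ring. Qed.

Lemma contract_ideal (Q : set L) : is_ideal Q -> is_ideal (loc_of @^-1` Q).
Proof.
move=> hQ; split=> [|x y Qx Qy|a x Qx] /=.
- by rewrite loc_of0; apply: ideal0.
- by rewrite loc_ofD; apply: idealD.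
- by rewrite loc_ofM; apply: idealM.
Qed.

Lemma localization_chain (C : nat -> set L) k : prime_chain C k ->
  prime_chain (fun i => loc_of @^-1` C i) k.
Proof.
case=> pC sC; split=> i ik.
  have [idC C1 CM] := pC i ik; split.
  - exact: contract_ideal.
  - by rewrite /preimage /= loc_of1.
  - by move=> x y /=; rewrite loc_ofM; apply: CM.
have [sub nsub] := sC i ik; split; first by move=> x; apply: sub.
have [idC _ _] := pC i (ltnW ik); have [idC' _ _] := pC i.+1 ik.
move=> h; apply: nsub => x Cx.
have [a [s [hs xE]]] := mk_loc_surj x.
rewrite xE mk_loc_den; apply: idealM => //; apply: h => /=.
by rewrite (loc_of_num _ hs) -xE; apply: idealM.
Qed.

Lemma localization_gen (s : seq A) a : ideal_gen [set` map loc_of s] (loc_of a) ->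
  exists u, ~ P u /\ ideal_gen [set` s] (u * a).
Proof.
have idg := ideal_gen_is_ideal [set` s]; have [_ P1 _] := P_prime.
pose Q : set L := [set x | exists b t ht, x = @mk_loc _ _ P_prime b t ht /\
  exists u, ~ P u /\ ideal_gen [set` s] (u * b)].
move=> h; suff [b [t [ht [/mk_locE [v [hv vE]] [u [hu hb]]]]]] : Q (loc_of a).
  exists (t * (u * v)); split; first by do 2 apply: prime_denomM => //.
  have -> : t * (u * v) * a = u * (v * (a * t)) by ring.
  by rewrite vE mulr1 mulrCA; apply: (idealM idg).
apply: h; last first.
  move=> _ /mapP [b bs ->]; exists b, 1, P1; split; first exact: mk_loc_eq.
  by exists 1; split=> //; rewrite mul1r; apply: ideal_gen_sub.
split.
- exists 0, 1, P1; split; first by rewrite -loc_of0; apply: mk_loc_eq.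
  by exists 1; rewrite mulr0; split=> //; apply: (ideal0 idg).
- move=> _ _ [b [t [ht [-> [u [hu hb]]]]]] [b' [t' [ht' [-> [u' [hu' hb']]]]]].
  rewrite mk_locD; eexists _, _, _; split; first by [].
  exists (u * u'); split; first exact: prime_denomM.
  have -> : u * u' * (b * t' + b' * t) = (u' * t') * (u * b) + (u * t) * (u' * b').
    by ring.
  by apply: (idealD idg); apply: (idealM idg).
- move=> x _ [b [t [ht [-> [u [hu hb]]]]]].
  have [c [r [hr ->]]] := mk_loc_surj x.
  rewrite mk_locM; eexists _, _, _; split; first by [].
  by exists u; split=> //; rewrite mulrCA; apply: (idealM idg).
Qed.

Lemma localization_regular (s : seq A) : [set` s] `<=` P ->
  (forall i, (i < size s)%N -> forall x,
     ideal_gen [set` take i s] (s`_i * x) -> ideal_gen [set` take i s] x) ->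
  regular_sequence (map loc_of s) /\ [set` map loc_of s] `<=` @nonunits L.
Proof.
have [idP P1 PM] := P_prime.
move=> sP reg; split; first split.
- move=> i; rewrite size_map => lti x.
  have [a [t [ht ->]]] := mk_loc_surj x.
  rewrite (nth_map 0) // -map_take => hx.
  have := @idealM _ _ (ideal_gen_is_ideal _) (loc_of t) _ hx.
  rewrite mulrCA -loc_of_num -loc_ofM => /localization_gen [u [hu]].
  rewrite mulrCA => /(reg _ lti) hua.
  have -> : mk_loc P_prime a ht =
      mk_loc P_prime 1 (prime_denomM P_prime hu ht) * loc_of (u * a).
    by rewrite -mk_loc_den; apply: mk_loc_eq; ring.
  apply: (idealM (ideal_gen_is_ideal _)).
  move: hua => /(_ (loc_of @^-1` ideal_gen [set` map loc_of (take i s)])).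
  apply; first by apply: contract_ideal; apply: ideal_gen_is_ideal.
  by move=> y /= ys; apply: ideal_gen_sub; apply: map_f.
- move=> genT; have : ideal_gen [set` map loc_of s] (loc_of 1) by rewrite genT.
  move=> /localization_gen [u [hu]]; rewrite mulr1 => gu.
  exact/hu/(ideal_gen_min idP sP).
- move=> _ /= /mapP [a ha ->] [y].
  have [b [t [ht ->]]] := mk_loc_surj y.
  rewrite mk_locM -loc_of1 => /mk_locE [u [hu e]].
  apply: (prime_denomM P_prime hu ht); have -> : u * t = u * (1 * (1 * t)) by ring.
  rewrite -e; have -> : u * (a * b * 1) = (u * b) * a by ring.
  by apply: (idealM idP); apply: sP.
Qed.

(** The sequence stays regular in the localization, where it bounds the depth
    from below and, peeled off prime by prime, the dimension as well. Chains of
    primes of the localization contract to [A], which bounds the dimension, and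
    hence the length of any regular sequence, from above. *)
Lemma localization_depth_dim (s : seq A) k :
    (forall C j, @prime_chain A C j -> (j <= k)%N) ->
    size s = k -> [set` s] `<=` P ->
    (forall i, (i < size s)%N -> forall x,
      ideal_gen [set` take i s] (s`_i * x) -> ideal_gen [set` take i s] x) ->
  krull_dim L k /\ local_depth L k.
Proof.
move=> bound sk sP reg; have [regL nuL] := localization_regular sP reg.
have boundL C j : @prime_chain L C j -> (j <= k)%N.
  by move=> /localization_chain /bound.
split; split.
- by have := regular_sequence_chain regL; rewrite size_map sk.
- by move=> j [C /boundL].
- by exists (map loc_of s); rewrite size_map.
- move=> j [s' [<- _ /regular_sequence_chain [C /boundL]]] //.
Qed.

End Localization.

(** * Noetherian rings *)

Lemma noetherian_surj (R A : comNzRingType) (f : {rmorphism R -> A}) :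
  (forall a, exists r, f r = a) -> is_noetherian R -> is_noetherian A.
Proof.
move=> fsurj nR I hI.
have [|s sE] := nR (f @^-1` I).
  split=> [|x y Ix Iy|a x Ix] /=; first by rewrite rmorph0; apply: ideal0.
    by rewrite rmorphD; apply: idealD.
  by rewrite rmorphM; apply: idealM.
exists (map f s); apply/seteqP; split; last first.
  apply: ideal_gen_min => // _ /= /mapP [x xs ->].
  have : ideal_gen [set` s] x by apply: ideal_gen_sub.
  by rewrite -sE.
move=> y Iy; have [x xE] := fsurj y; subst y.
have [c ->] : exists c : nat -> R, x = \sum_(i < size s) c i * s`_i.
  by apply: ideal_gen_sumP; rewrite -sE.
rewrite rmorph_sum; apply: ideal_sum; first exact: ideal_gen_is_ideal.
move=> i; rewrite rmorphM; apply: (idealM (ideal_gen_is_ideal _)).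
by apply: ideal_gen_sub => /=; apply: map_f; apply: mem_nth.
Qed.

Lemma field_noetherian (K : fieldType) : is_noetherian K.
Proof.
move=> I hI; have [[x [Ix x0]]|h] := pselect (exists x, I x /\ x != 0).
  exists [:: x]; apply/seteqP; split; last first.
    by apply: ideal_gen_min => // y /=; rewrite inE => /eqP ->.
  move=> y _; have -> : y = (y / x) * x by rewrite divfK.
  apply: (idealM (ideal_gen_is_ideal _)).
  by apply: ideal_gen_sub; rewrite /= inE.
exists [::]; apply/seteqP; split; last by apply: ideal_gen_min.
move=> y Iy; have [->|y0] := eqVneq y 0.
  by apply: ideal0; apply: ideal_gen_is_ideal.
by exfalso; apply: h; exists y.
Qed.

Section HilbertBasis.
Variables (R : comNzRingType) (R_noeth : is_noetherian R).
Variables (I : set {poly R}) (I_ideal : is_ideal I).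

Let lead k : set R :=
  [set a | exists f : {poly R}, [/\ I f, (size f <= k.+1)%N & f`_k = a]].

Let lead_ideal k : is_ideal (lead k).
Proof.
split=> [|_ _ [f [If sf <-]] [g [Ig sg <-]]|a _ [f [If sf <-]]].
- by exists 0; rewrite size_poly0 coef0; split=> //; apply: ideal0.
- exists (f + g); rewrite coefD; split=> //; first exact: idealD.
  by apply: leq_trans (size_polyD _ _) _; rewrite geq_max sf.
- exists (a%:P * f); rewrite coefCM; split=> //; first exact: idealM.
  by rewrite mul_polyC; apply: leq_trans (size_scale_leq _ _) sf.
Qed.

Let leadS k j : (k <= j)%N -> lead k `<=` lead j.
Proof.
move=> kj _ [f [If sf <-]]; exists (f * 'X^(j - k)); split.
- by rewrite mulrC; apply: idealM.
- apply: leq_trans (size_polyMleq _ _) _; rewrite size_polyXn; lia.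
- by rewrite coefMXn ltnNge leq_subr subKn.
Qed.

Let lead_lift k (t : seq R) : [set` t] `<=` lead k -> exists s : seq {poly R},
  [/\ map (fun f : {poly R} => f`_k) s = t, [set` s] `<=` I &
      forall f, f \in s -> (size f <= k.+1)%N].
Proof.
elim: t => [|a t IHt] h; first by exists [::].
have [|s [<- sI ss]] := IHt.
  by move=> b bt; apply: h; rewrite /= inE [b \in t]bt orbT.
have [|f [If sf <-]] := h a; first by rewrite /= inE eqxx.
exists (f :: s); split=> // g /=; rewrite inE => /orP [/eqP -> //|]; last exact: ss.
exact: sI.
Qed.

(** Lifts to [I] of generators of [lead k], combined and shifted by
    ['X^(j - k)], cancel the coefficient of degree [j]. *)
Let lead_reduce k : exists s : seq {poly R}, [set` s] `<=` I /\
  forall j (f : {poly R}), (k <= j)%N -> lead k f`_j -> (size f <= j.+1)%N ->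
    exists g : {poly R}, ideal_gen [set` s] g /\ (size (f - g)%R <= j)%N.
Proof.
have [t tE] := R_noeth (lead_ideal k).
have [|s [ts sI ss]] := @lead_lift k t.
  by rewrite tE; apply: ideal_gen_sub.
exists s; split=> // j f kj; rewrite tE => /ideal_gen_sumP [c cE] sf.
pose g := \sum_(i < size s) ((c i)%:P * 'X^(j - k)) * s`_i.
have size_t : size t = size s by rewrite -ts size_map.
exists g; split; first exact: (@ideal_gen_sum _ s (fun i => (c i)%:P * 'X^(j - k))).
have gj i : (j <= i)%N -> g`_i = (i == j)%:R * f`_j.
  move=> ji; rewrite cE size_t coef_sum mulr_sumr; apply: eq_bigr => l _.
  rewrite -mulrA coefCM -commr_polyXn coefMXn ifN ?subKn; last by lia.
  rewrite mulrCA; congr (_ * _); rewrite -ts (nth_map 0) //.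
  have [->|ne] := eqVneq i j; first by rewrite mul1r subKn.
  rewrite mul0r nth_default //; apply: leq_trans (ss _ (mem_nth _ _)) _ => //.
  lia.
apply/leq_sizeP => i ji; rewrite coefB gj //.
have [->|ne] := eqVneq i j; first by rewrite mul1r subrr.
by rewrite mul0r subr0 nth_default //; apply: leq_trans sf _; lia.
Qed.

Let low_degree k : exists s : seq {poly R}, [set` s] `<=` I /\
  forall f : {poly R}, I f -> (size f <= k)%N -> ideal_gen [set` s] f.
Proof.
elim: k => [|k [s [sI sgen]]].
  exists [::]; split=> // f _; rewrite leqn0 size_poly_eq0 => /eqP ->.
  by apply: ideal0; apply: ideal_gen_is_ideal.
have [s' [s'I red]] := lead_reduce k.
have hcat := ideal_gen_is_ideal [set` s ++ s'].
exists (s ++ s'); split; first by move=> f /=; rewrite mem_cat => /orP [/sI|/s'I].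
move=> f If sf; have [|g [gg sfg]] := red k f (leqnn _) _ sf.
  by exists f.
have Ig : I g by apply: ideal_gen_min gg.
rewrite -(subrK g f); apply: (idealD hcat).
  apply: (ideal_gen_min hcat) (sgen _ _ sfg); last exact: idealB.
  by move=> x xs; apply: ideal_gen_sub; rewrite /= mem_cat [x \in s]xs.
apply: (ideal_gen_min hcat) gg.
by move=> x xs; apply: ideal_gen_sub; rewrite /= mem_cat [x \in s']xs orbT.
Qed.

(** The ideal of all leading coefficients is reached in some degree [N], from
    which on lifts of its generators reduce the degree; below [N], induction on
    the degree provides finitely many more generators. *)
Lemma poly_ideal_fg : exists s : seq {poly R}, I = ideal_gen [set` s].
Proof.
pose leads : set R := [set a | exists k, lead k a].
have leads_ideal : is_ideal leads.
  split=> [|a b [k ka] [j jb]|a b [k kb]].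
  - by exists 0%N; apply: ideal0.
  - exists (maxn k j); apply: idealD => //.
      by apply: leadS ka; rewrite leq_maxl.
    by apply: leadS jb; rewrite leq_maxr.
  - by exists k; apply: idealM.
have [t tE] := R_noeth leads_ideal.
have [N hN] : exists N, [set` t] `<=` lead N.
  have : [set` t] `<=` leads by rewrite tE; apply: ideal_gen_sub.
  elim: (t) => [|a u IHu] h; first by exists 0%N.
  have [|N uN] := IHu.
    by move=> b bu; apply: h; rewrite /= inE [b \in u]bu orbT.
  have [k ak] : leads a by apply: h; rewrite /= inE eqxx.
  exists (maxn N k) => b /=; rewrite inE => /orP [/eqP ->|bu].
    by apply: leadS ak; rewrite leq_maxr.
  by apply: leadS (uN _ bu); rewrite leq_maxl.
have leadN k : lead k `<=` lead N.
  move=> a ka; have : leads a by exists k.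
  by rewrite tE; apply: ideal_gen_min.
have [s [sI sgen]] := low_degree N; have [s' [s'I red]] := lead_reduce N.
have hcat := ideal_gen_is_ideal [set` s ++ s'].
exists (s ++ s'); apply/seteqP; split; last first.
  by apply: ideal_gen_min => // f /=; rewrite mem_cat => /orP [/sI|/s'I].
suff h k (f : {poly R}) : I f -> (size f <= N + k)%N -> ideal_gen [set` s ++ s'] f.
  by move=> f If; apply: (h (size f)) => //; apply: leq_addl.
elim: k f => [|k IHk] f If.
  rewrite addn0 => sf; apply: (ideal_gen_min hcat) (sgen _ If sf).
  by move=> x xs; apply: ideal_gen_sub; rewrite /= mem_cat [x \in s]xs.
rewrite addnS => sf; have [||g [gg sfg]] := red (N + k)%N f _ _ sf.
- exact: leq_addr.
- by apply: (leadN (N + k)%N); exists f.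
have Ig : I g by apply: ideal_gen_min gg.
rewrite -(subrK g f); apply: (idealD hcat).
  by apply: IHk => //; apply: idealB.
apply: (ideal_gen_min hcat) gg.
by move=> x xs; apply: ideal_gen_sub; rewrite /= mem_cat [x \in s']xs orbT.
Qed.

End HilbertBasis.

Lemma poly_noetherian (R : comNzRingType) : is_noetherian R -> is_noetherian {poly R}.
Proof. by move=> nR I hI; apply: poly_ideal_fg. Qed.

(** * Iterated polynomial rings and chains of primes *)

Fixpoint tower (K : comNzRingType) (s : nat) : comNzRingType :=
  if s is s'.+1 then {poly (tower K s')} else K.

Lemma tower_noetherian (K : fieldType) s : is_noetherian (tower K s).
Proof.
by elim: s => [|s IHs]; [exact: field_noetherian|exact: poly_noetherian].
Qed.

Section Eval.
Variables (K A : comNzRingType) (phi : {rmorphism K -> A}).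

Definition eval1 (R : comNzRingType) (f : {rmorphism R -> A}) (y : A) :
  {rmorphism {poly R} -> A} := horner_morph (fun x => mulrC y (f x)).

Fixpoint teval s (y : nat -> A) : {rmorphism tower K s -> A} :=
  if s is s'.+1 return {rmorphism tower K s -> A}
  then eval1 (teval s' (y \o S)) (y 0%N) else phi.

Lemma eval1_cons (R : comNzRingType) (f : {rmorphism R -> A}) (y : A) q c :
  eval1 f y (q * 'X + c%:P) = eval1 f y q * y + f c.
Proof. by rewrite rmorphD rmorphM /= horner_morphX horner_morphC. Qed.

End Eval.

Lemma rmorph_teval (K A B : comNzRingType) (phi : {rmorphism K -> A})
    (psi : {rmorphism K -> B}) (f : {rmorphism A -> B}) :
  (forall c, f (phi c) = psi c) ->
  forall s y q, f (teval phi s y q) = teval psi s (f \o y) q.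
Proof.
move=> fphi; elim=> [|s IHs] y q; first exact: fphi.
elim/poly_ind: q => [|q c IHq]; first by rewrite !rmorph0.
rewrite [teval phi _ _ _]eval1_cons [RHS]eval1_cons -IHq rmorphD rmorphM.
by rewrite IHs.
Qed.

(** Reading a nonzero polynomial from its lowest term in the variable
    evaluated at [y 0]: the powers of [y 0] are cancelled modulo [P 0], the
    other terms are absorbed by [P 1], and what remains is a nonzero polynomial
    in the next variables. *)
Lemma chain_not_dependent (K : fieldType) (A : comNzRingType)
    (phi : {rmorphism K -> A}) s (P : nat -> set A) (y : nat -> A)
    (Q : tower K s) :
    prime_chain P s -> (forall i, (i < s)%N -> P i.+1 (y i) /\ ~ P i (y i)) ->
  Q != 0 -> ~ P 0%N (teval phi s y Q).
Proof.
elim: s P y Q => [|s IHs] P y Q cP yP.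
  move=> Q0 PQ; have [idP P1 _] : is_prime (P 0%N) by apply: cP.1.
  apply: P1; rewrite -(rmorph1 phi) -(mulVf Q0) rmorphM.
  exact: (idealM idP).
have [pP sP] := cP.
have [id0 _ M0] := pP 0%N isT; have [id1 _ _] := pP 1%N isT.
have [y1 y0] := yP 0%N isT.
elim/poly_ind: Q => [|Q c IHQ]; first by rewrite eqxx.
rewrite [teval _ _ _ _]eval1_cons.
have [->|c0 _] := eqVneq c 0.
  rewrite !addr0 rmorph0 addr0 => QX /M0 [|//]; apply: IHQ.
  by apply: contraNneq QX => ->; rewrite mul0r.
move=> P0; have /(idealB id1) : P 1%N (eval1 (teval phi s (y \o S)) (y 0%N) Q *
    y 0%N + teval phi s (y \o S) c) by apply: (sP 0%N isT).1.
move=> /(_ _ (idealM id1 (eval1 (teval phi s (y \o S)) (y 0%N) Q) y1)).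
rewrite addrC addKr; apply: (IHs (P \o S)) => //.
  by split=> i ik; [apply: pP|apply: sP].
by move=> i ik; apply: (yP i.+1).
Qed.

(** * Algebraic dependence in a polynomial ring *)

Section Dependence.
Variables (K : fieldType).

(** Exponents are encoded as lists, so that they follow the recursion of
    [tower]. *)
Fixpoint words s D : seq (seq nat) :=
  if s is s'.+1 then [seq i :: l | i <- iota 0 D, l <- words s' D] else [:: [::]].

Fixpoint tpoly s D (c : seq nat -> K) : tower K s :=
  if s is s'.+1 return tower K s
  then \poly_(i < D) tpoly s' D (fun l => c (i :: l)) else c [::].

Fixpoint tmon (A : comNzRingType) s (y : nat -> A) (l : seq nat) : A :=
  if s is s'.+1 then y 0%N ^+ head 0%N l * tmon s' (y \o S) (behead l) else 1.

Lemma size_words s D : size (words s D) = (D ^ s)%N.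
Proof. by elim: s => [|s IHs] //=; rewrite size_allpairs size_iota IHs expnS. Qed.

Lemma words_uniq s D : uniq (words s D).
Proof.
elim: s => [|s IHs] //=; apply: allpairs_uniq => //; first exact: iota_uniq.
by move=> [i l] [i' l'] _ _ [-> ->].
Qed.

Lemma words_le s D l i : l \in words s D -> (nth 0%N l i <= D)%N.
Proof.
elim: s l i => [|s IHs] l i /=; first by rewrite inE => /eqP ->; rewrite nth_nil.
move=> /allpairsP [[j l'] [/=]]; rewrite mem_iota => /andP [_ jD] hl' ->.
case: i => [|i] /=; first by apply: ltnW.
exact: IHs.
Qed.

Lemma tpoly_neq0 s D (c : seq nat -> K) l : l \in words s D -> c l != 0 ->
  tpoly s D c != 0.
Proof.
elim: s c l => [|s IHs] c l; first by rewrite inE => /eqP ->.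
move=> /allpairsP [[j l'] [/=]]; rewrite mem_iota add0n => /andP [_ jD] hl' -> cl.
apply/negP => /eqP /(congr1 (fun p : {poly _} => p`_j)).
by rewrite coef_poly jD coef0; apply/eqP; apply: IHs hl' cl.
Qed.

Lemma teval_tpoly (A : comNzRingType) (phi : {rmorphism K -> A}) s D y c :
  teval phi s y (tpoly s D c) = \sum_(l <- words s D) phi (c l) * tmon s y l.
Proof.
elim: s y c => [|s IHs] y c /=; first by rewrite big_seq1 mulr1.
rewrite big_allpairs_dep /= poly_def rmorph_sum.
have -> : iota 0 D = index_iota 0 D by rewrite /index_iota subn0.
rewrite big_mkord; apply: eq_bigr => i _.
rewrite -mul_polyC rmorphM rmorphXn /= horner_morphX horner_morphC IHs mulr_suml.
by apply: eq_bigr => l _; rewrite -mulrA [tmon _ _ _ * _]mulrC.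
Qed.

Lemma msize_mul_le n (p q : {mpoly K[n]}) :
  (msize (p * q) <= (msize p + msize q).-1)%N.
Proof.
have [->|p0] := eqVneq p 0; first by rewrite mul0r msize0.
have [->|q0] := eqVneq q 0; first by rewrite mulr0 msize0.
by rewrite msizeM.
Qed.

Lemma msize_tmon n s e D (y : nat -> {mpoly K[n]}) l :
    (forall i, (i < s)%N -> (msize (y i) <= e.+1)%N) ->
  (forall i, (nth 0%N l i <= D)%N) -> (msize (tmon s y l) <= (s * (D * e)).+1)%N.
Proof.
elim: s y l => [|s IHs] y l ye lD /=; first by rewrite msize1.
have := IHs (y \o S) (behead l) (fun i => ye i.+1) _.
have lD' i : (nth 0%N (behead l) i <= D)%N by rewrite nth_behead; apply: lD.
move=> /(_ lD') h.
have aux a b p q x : (a <= p.+1)%N -> (b <= q.+1)%N -> (p + q <= x)%N ->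
  ((a + b).-1 <= x.+1)%N by lia.
have hX k : (msize (y 0%N ^+ k) <= (k * e).+1)%N.
  elim: k => [|k IHk]; first by rewrite expr0 msize1.
  rewrite exprS; apply: leq_trans (msize_mul_le _ _) _.
  by apply: aux (ye 0%N isT) IHk _; rewrite mulSn.
apply: leq_trans (msize_mul_le _ _) _; apply: aux (hX (head 0%N l)) h _.
by rewrite mulSn leq_add2r leq_mul2r -nth0 lD orbT.
Qed.

Lemma card_bmnm n B : (0 < B)%N -> (#|{: 'X_{1..n < B}}| <= B ^ n)%N.
Proof.
case: B => // B _.
pose f (m : 'X_{1..n < B.+1}) : {ffun 'I_n -> 'I_B.+1} := [ffun i => inord (m i)].
have f_inj : injective f.
  move=> m m' /ffunP e; apply: val_inj; apply/mnmP => i.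
  have := e i; rewrite !ffunE => /(congr1 (@nat_of_ord _)).
  have lt (u : 'X_{1..n < B.+1}) : (u i < B.+1)%N.
    apply: leq_ltn_trans (bmdeg u); rewrite mdegE (bigD1 i) //=; exact: leq_addr.
  by rewrite !inordK.
by have := leq_card f f_inj; rewrite card_ffun !card_ord.
Qed.

(** The monomials with exponents below [D] in [s > n] elements of degree at
    most [e] are [D ^ s] polynomials in a space whose dimension grows only like
    [D ^ n]. *)
Lemma mpoly_dependent n s (y : nat -> {mpoly K[n]}) : (n < s)%N ->
  exists2 Q : tower K s, Q != 0 & teval (@mpolyC n K) s y Q = 0.
Proof.
move=> ns.
pose e := (\max_(i < s) msize (y i))%N.
have ye i : (i < s)%N -> (msize (y i) <= e.+1)%N.
  by move=> h; apply: leqW; apply: (leq_bigmax (Ordinal h)).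
(* With [C = (s * e).+1], [B <= C * D] and [B ^ n <= C ^ n * D ^ n < D ^ n.+1]. *)
pose D := ((s * e).+1 ^ n).+1; pose B := (s * (D * e)).+1.
pose W := words s D; pose N := #|{: 'X_{1..n < B}}|.
have ltN : (N < size W)%N.
  rewrite size_words; apply: leq_ltn_trans (card_bmnm _ _) _ => //.
  apply: (@leq_ltn_trans (((s * e).+1 * D) ^ n)).
    by case: (n) => // k; rewrite leq_exp2r // /B /D; lia.
  rewrite expnMn; apply: (@leq_trans (D ^ n.+1)); last by rewrite leq_pexp2l.
  by rewrite expnS ltn_pmul2r ?expn_gt0.
pose M : 'M[K]_(size W, N) :=
  \matrix_(i, j) (tmon s y (nth [::] W i))@_(bmnm (enum_val j)).
have : kermx M != 0.
  rewrite kermx_eq0 /row_free neq_ltn (leq_ltn_trans (rank_leq_col M)) //.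
move=> /rowV0Pn [u /sub_kermxP uM u0].
have {u0} [i0 ui0] : exists i, u 0 i != 0.
  apply: contrapT => h; move/eqP: u0; apply; apply/rowP => i; rewrite mxE.
  by apply/eqP/negP => hi; apply: h; exists i; apply/negP.
pose c (l : seq nat) := if insub (index l W) is Some i then u 0 i else 0.
have cE (i : 'I_(size W)) : c (nth [::] W i) = u 0 i.
  by rewrite /c index_uniq ?words_uniq // valK.
exists (tpoly s D c).
  by apply: (tpoly_neq0 (l := nth [::] W i0)); [apply: mem_nth|rewrite cE].
rewrite teval_tpoly (big_nth [::]) big_mkord; apply/mpolyP => m.
rewrite raddf_sum mcoeff0 /=.
under eq_bigr => i _ do rewrite mcoeffCM cE.
have [ltm|lem] := ltnP (mdeg m) B; last first.
  rewrite big1 // => i _; rewrite [X in _ * X](_ : _ = 0) ?mulr0 //.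
  apply: memN_msupp_eq0; apply: msize_mdeg_ge; apply: leq_trans lem.
  by apply: msize_tmon => // j; apply: (words_le (s := s)); apply: mem_nth.
have := congr1 (fun v : 'rV_N => v 0 (enum_rank (BMultinom ltm))) uM.
rewrite !mxE => h; rewrite -[RHS]h; apply: eq_bigr => i _.
by rewrite mxE enum_rankK.
Qed.

End Dependence.

(** Elements [y i] of [P i.+1] outside [P i] satisfy no polynomial equation over
    [K], whereas more than [n] elements of a polynomial ring in [n] variables
    always do. *)
Lemma embedded_chain_le (K : fieldType) n (A : comNzRingType)
    (phi : {rmorphism K -> A}) (f : {rmorphism A -> {mpoly K[n]}}) :
    injective f -> (forall c, f (phi c) = c%:MP) ->
  forall (P : nat -> set A) k, prime_chain P k -> (k <= n)%N.
Proof.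
move=> f_inj fphi P k cP; rewrite leqNgt; apply/negP => nk.
have /choice [y yP] : forall i, exists x, (i < k)%N -> P i.+1 x /\ ~ P i x.
  move=> i; have [ik|] := boolP (i < k)%N; last by exists 0.
  have [_ nsub] := cP.2 i ik.
  apply: contrapT => h; apply: nsub => x Px; apply: contrapT => nPx.
  by apply: h; exists x.
have [Q Q0 QE] := mpoly_dependent (f \o y) nk.
apply: (chain_not_dependent (phi := phi) cP yP Q0).
suff -> : teval phi k y Q = 0 by apply: ideal0; case: (cP.1 0%N isT).
by apply: f_inj; rewrite rmorph0 (rmorph_teval (psi := @mpolyC n K)).
Qed.

(** * Zariski's lemma *)

Section GDomain.
Variables (L : fieldType).

(** The image of [phi] is a G-domain: inverting the single element [phi r]
    turns it into a field. *)
Definition gdomain (R : comNzRingType) (phi : {rmorphism R -> L}) := exists r,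
  phi r != 0 /\ forall x, phi x != 0 -> exists k c, phi x * phi c = phi r ^+ k.

Variables (R : comNzRingType) (phi : {rmorphism R -> L}).

Definition algebraic_over (a : L) :=
  exists p : {poly R}, map_poly phi p != 0 /\ (map_poly phi p).[a] = 0.

Variable a : L.
Local Notation ev := (eval1 phi a).

Let evE p : ev p = (map_poly phi p).[a]. Proof. by []. Qed.

(** If [a] were transcendental, [1 + X * b] would divide a power of [b] in a
    polynomial ring over [L], although it is prime to [b]. *)
Lemma gdomain_algebraic : gdomain ev -> algebraic_over a.
Proof.
case=> b [b0 hb]; apply: contrapT => nalg.
have inj p : ev p = 0 -> map_poly phi p = 0.
  move=> p0; apply/eqP/negP => /negP pn0; apply: nalg; exists p.
  by rewrite -evE.
pose B := map_poly phi b.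
have B0 : B != 0 by apply: contraNneq b0 => h; rewrite evE -/B h horner0.
pose x : {poly R} := 1 + 'X * b.
have xE : map_poly phi x = 1 + 'X * B.
  by rewrite rmorphD rmorphM rmorph1 /= map_polyX.
have [|k [c hc]] := hb x.
  apply/eqP => /inj; rewrite xE => /(congr1 (fun p : {poly L} => p`_0)).
  rewrite coefD coef1 coefXM coef0 /= addr0 => /eqP; apply/negP; exact: oner_neq0.
have : map_poly phi (x * c - b ^+ k) = 0.
  by apply: inj; rewrite rmorphB rmorphM rmorphXn /= hc subrr.
rewrite rmorphB rmorphM rmorphXn /= xE -/B => /eqP; rewrite subr_eq0 => /eqP e.
have cop : coprimep (1 + 'X * B) (B ^+ k).
  apply: coprimep_expr; apply/Bezout_coprimepP; exists (1, - 'X) => /=.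
  by rewrite mul1r mulNr addrK eqpxx.
have := dvdp_mulr (map_poly phi c) (dvdpp (1 + 'X * B)); rewrite e.
move=> /(coprimepP _ _ cop) => /(_ (dvdpp _)) /eqp_size.
have sXB : size ('X * B) = (size B).+1 by rewrite mulrC size_mulX.
rewrite size_poly1 addrC size_polyDl sXB ?size_poly1 ?ltnS ?lt0n ?size_poly_eq0 //.
by move=> /eqP; rewrite eqSS size_poly_eq0 (negbTE B0).
Qed.

(** The lowest nonzero coefficient of an equation of [b] is a multiple of
    [b]. *)
Lemma algebraic_divides (b : L) : b != 0 -> algebraic_over b ->
  exists s (h : {poly R}), phi s != 0 /\ phi s = b * (map_poly phi h).[b].
Proof.
move=> b0 [q []]; elim/poly_ind: q => [|q c IHq]; first by rewrite rmorph0 eqxx.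
rewrite rmorphD rmorphM /= map_polyX map_polyC /= hornerMXaddC.
have [c0|c0 _] := eqVneq (phi c) 0.
  rewrite c0 !addr0 mulf_eq0 negb_or => /andP [q0 _] /eqP.
  by rewrite mulf_eq0 (negbTE b0) orbF => /eqP /(IHq q0).
move=> /eqP; rewrite addrC addr_eq0 => /eqP cE; exists c, (- q); split=> //.
by rewrite cE rmorphN hornerN mulrN mulrC.
Qed.

(** Write [c] for a leading coefficient of an equation of [a], so that [a] is
    integral over [R[1/c]], and [s] for a multiple in [R] of the element [b] of
    [R[a]] whose inversion yields a field. The inverse of [x] in [R[a, 1/s]] is
    integral over [R[1/c]]; multiplying its equation by a power of [x] shows
    that it lies in [R[1/(c * s)]]. *)
Lemma gdomain_base : gdomain ev -> gdomain phi.
Proof.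
move=> gd; have [p [P0 Pa]] := gdomain_algebraic gd.
case: gd => b [b0 hb].
pose P := map_poly phi p; pose e := (size P).-1; pose c := p`_e.
have szP : size P = e.+1 by rewrite /e prednK // lt0n size_poly_eq0.
have cE : phi c = lead_coef P by rewrite /c /lead_coef -coef_map.
have c0 : phi c != 0 by rewrite cE lead_coef_eq0.
have e_gt0 : (0 < e)%N.
  rewrite lt0n; apply/eqP => e0; move: P0 Pa; rewrite -/P.
  rewrite (size1_polyC (p := P)) ?szP ?e0 // hornerC polyC_eq0.
  by move=> /eqP h /h.
(* Multiplied by [c ^+ e.-1], the equation of [a] is monic in [c * a]. *)
have int_a : integralOver phi (phi c * a).
  pose q : {poly L} := 'X^e + \poly_(i < e) (phi (p`_i * c ^+ (e.-1 - i))).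
  have szq : (size (\poly_(i < e) (phi (p`_i * c ^+ (e.-1 - i))))%R <
      size ('X^e : {poly L}))%N.
    by rewrite size_polyXn ltnS size_poly.
  apply: (@integral_root_monic _ _ _ _ q).
  - by rewrite monicE lead_coefDl // lead_coefXn.
  - rewrite /root hornerD hornerXn horner_poly /=; apply/eqP.
    transitivity (phi c ^+ e.-1 * P.[a]); last by rewrite Pa mulr0.
    rewrite horner_coef szP big_ord_recr /=.
    rewrite [in RHS]addrC mulrDr; congr (_ + _).
      have -> : P`_e = phi c by rewrite /c -coef_map.
      by rewrite exprMn mulrA -exprSr prednK.
    rewrite mulr_sumr; apply: eq_bigr => i _.
    rewrite coef_map rmorphM rmorphXn /= exprMn.
    have -> : phi c ^+ e.-1 = phi c ^+ (e.-1 - i) * phi c ^+ i.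
      by rewrite -exprD subnK // -ltnS prednK.
    by ring.
  - apply/integral_poly => i; rewrite coefD coefXn coef_poly.
    apply: integral_add; first exact: integral_nat.
    by case: ifP => _; [exact: integral_id|exact: integral0].
have int_ev g : exists N, integralOver phi (phi c ^+ N * ev g).
  have sg : (size (map_poly phi g) <= size g)%N by exact: size_poly.
  exists (size g); rewrite evE (horner_coef_wide _ sg) mulr_sumr.
  apply: (big_ind (integralOver phi)); [exact: integral0|exact: integral_add|].
  move=> i _; rewrite coef_map /=.
  have lei : (i <= size g)%N by apply: ltnW.
  have -> : phi c ^+ size g * (phi g`_i * a ^+ i) =
      phi (c ^+ (size g - i) * g`_i) * (phi c * a) ^+ i.
    rewrite rmorphM rmorphXn /= exprMn.
    have -> : phi c ^+ size g = phi c ^+ (size g - i) * phi c ^+ i.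
      by rewrite -exprD subnK.
    by ring.
  apply: integral_mul; first exact: integral_id.
  by elim: (i : nat) => [|j IHj]; [exact: integral1|rewrite exprS; apply: integral_mul].
have [N [q mq rq]] := int_ev b; set beta := phi c ^+ N * ev b in rq.
have beta0 : beta != 0 by rewrite mulf_neq0 // expf_neq0.
have [|s [h [s0 sE]]] := algebraic_divides beta0.
  by exists q; split; [rewrite monic_neq0 // monic_map|apply/rootP].
have [h' h'E] : exists h' : {poly R}, phi s = ev b * ev h'.
  exists ((c ^+ N)%:P * (h \Po ((c ^+ N)%:P * b))).
  rewrite sE rmorphM /= horner_morphC rmorphXn /= [ev (_ \Po _)]evE.
  rewrite map_comp_poly horner_comp -evE rmorphM /= horner_morphC rmorphXn.
  by rewrite /beta; ring.
exists (c * s); rewrite rmorphM; split; first exact: mulf_neq0.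
move=> x x0; have [|k [g hg]] := hb x%:P; first by rewrite /= horner_morphC.
rewrite /= horner_morphC in hg.
have [M [r mr rr]] := int_ev (g * h' ^+ k).
set y := ev (g * h' ^+ k) in rr.
have xy : phi x * y = phi s ^+ k.
  by rewrite /y rmorphM rmorphXn mulrA hg h'E exprMn.
pose t := c ^+ M * s ^+ k.
have tE : phi t = phi x * (phi c ^+ M * y).
  by rewrite rmorphM !rmorphXn mulrCA xy.
set Y := phi c ^+ M * y in rr tE.
pose f := (size r).-1.
have szr : size r = f.+1 by rewrite /f prednK // lt0n size_poly_eq0 monic_neq0.
pose w := - \sum_(i < f) r`_i * t ^+ i * x ^+ (f.-1 - i).
have tf : phi t ^+ f = phi x * phi w.
  have : \sum_(i < f.+1) phi r`_i * Y ^+ i = 0.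
    transitivity (map_poly phi r).[Y]; last exact/rootP.
    rewrite horner_coef size_map_poly_id0; last first.
      by rewrite (monicP mr) rmorph1 oner_neq0.
    by rewrite szr; apply: eq_bigr => i _; rewrite coef_map.
  rewrite big_ord_recr /= -[r`_f]/(lead_coef r) (monicP mr) rmorph1 mul1r addrC.
  move=> /eqP; rewrite addr_eq0 => /eqP Yf.
  rewrite tE exprMn Yf /w rmorphN mulrN mulrN rmorph_sum !mulr_sumr; congr (- _).
  apply: eq_bigr => i _; rewrite !rmorphM !rmorphXn /= tE [(phi x * Y) ^+ i]exprMn.
  have -> : phi x ^+ f = phi x * (phi x ^+ i * phi x ^+ (f.-1 - i)).
    rewrite -exprD -exprS; congr (_ ^+ _); have := ltn_ord i; lia.
  by ring.
exists (M * f + k * f)%N, (w * (c ^+ (k * f) * s ^+ (M * f))).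
rewrite rmorphM mulrA -tf rmorphM !rmorphXn /= rmorphM !rmorphXn.
by rewrite !exprMn !exprD -!exprM; ring.
Qed.

End GDomain.

Lemma teval_gdomain_algebraic (K : fieldType) (L : fieldType)
    (phi : {rmorphism K -> L}) s (y : nat -> L) :
  gdomain (teval phi s.+1 y) -> algebraic_over phi (y s).
Proof.
elim: s y => [|s IHs] y; first exact: gdomain_algebraic.
by move=> /gdomain_base /IHs.
Qed.

(** Zariski's lemma: peeling off the generators one at a time, each subalgebra
    generated by the remaining ones is a field up to inverting one element,
    and the generator just removed is algebraic over the next one. *)
Lemma zariski (K L : fieldType) (phi : {rmorphism K -> L}) s (y : nat -> L) :
    (forall x, exists q, teval phi s.+1 y q = x) -> algebraic_over phi (y s).
Proof.
move=> surj; apply: teval_gdomain_algebraic; exists 1.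
rewrite rmorph1 oner_neq0; split=> // x x0; have [c cE] := surj (teval phi s.+1 y x)^-1.
by exists 0%N, c; rewrite cE mulfV.
Qed.

(** * Monomial ideals *)

Section MonomialIdeals.
Variables (K : fieldType) (n : nat).
Local Notation S := {mpoly K[n]}.
Local Notation mon := 'X_{1..n}.
Implicit Types (M N : set mon) (f g : S) (m a b : mon).

Definition monideal M : set S := ideal_gen [set ('X_[a] : S) | a in M].

Lemma monideal_ideal M : is_ideal (monideal M).
Proof. exact: ideal_gen_is_ideal. Qed.

Lemma monidealP M f :
  monideal M f <-> forall m, m \in msupp f -> exists2 a, M a & (a <= m)%MM.
Proof.
split=> [|h].
  pose Q : set S := [set f | forall m, m \in msupp f -> exists2 a, M a & (a <= m)%MM].
  move=> h; suff : Q f by []; apply: h.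
    split=> [m|x y Qx Qy m|c x Qx m].
    - by rewrite msupp0.
    - by move=> /msuppD_le; rewrite mem_cat => /orP [/Qx|/Qy].
    - move=> /msuppM_le /allpairsP [[m1 m2] /= [_ /Qx [a Ma am] ->]].
      by exists a => //; apply: lepm_trans am (lem_addl _ _).
  move=> _ [a Ma <-] m /mem_msuppXP <-; exists a => //; exact: lepm_refl.
rewrite [f]mpolyE; apply: ideal_bigsum; first exact: monideal_ideal.
move=> m /h [a Ma am].
rewrite -(submK am) mpolyXD -mul_mpolyC mulrA; apply: (idealM (monideal_ideal M)).
by apply: ideal_gen_sub; exists a.
Qed.

Lemma monidealX M m : monideal M 'X_[m] <-> exists2 a, M a & (a <= m)%MM.
Proof.
rewrite monidealP; split=> [|h m' /mem_msuppXP <- //].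
by apply; rewrite msuppX inE.
Qed.

Definition madd M N : set mon := [set m | exists a b, [/\ M a, N b & m = (a + b)%MM]].

Lemma monideal_mul M N : ideal_mul (monideal M) (monideal N) = monideal (madd M N).
Proof.
have idMN := monideal_ideal (madd M N).
apply/seteqP; split.
  apply: ideal_gen_min => // _ [x [y [/monidealP Mx /monidealP Ny ->]]].
  apply/monidealP => m /msuppM_le /allpairsP [[m1 m2] /=].
  move=> [/Mx [a Ma am] /Ny [b Nb bm] ->].
  exists (a + b)%MM; first by exists a, b.
  by apply/mnm_lepP => i; rewrite !mnmDE leq_add //; apply/mnm_lepP.
apply: ideal_gen_min; first exact: ideal_gen_is_ideal.
move=> _ [_ [a [b [Ma Nb ->]]] <-]; rewrite mpolyXD.
by apply: ideal_mul_mem; apply: ideal_gen_sub; [exists a|exists b].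
Qed.

Fixpoint mpow M k : set mon := if k is k'.+1 then madd M (mpow M k') else [set 0%MM].

Lemma monideal_pow M k : ideal_pow (monideal M) k = monideal (mpow M k).
Proof.
elim: k => [|k IHk] /=; last by rewrite IHk monideal_mul.
apply/seteqP; split=> // f _; apply/monidealP => m _.
by exists 0%MM => //; apply/mnm_lepP => i; rewrite mnm0E.
Qed.

Lemma mpow1 M a : M a -> mpow M 1 a.
Proof. by move=> Ma; exists a, 0%MM; rewrite addm0. Qed.

Section Equigenerated.
Variables (M : set mon) (d : nat).
Hypothesis M_deg : forall a, M a -> mdeg a = d.

Lemma mdeg_mpow k a : mpow M k a -> mdeg a = (k * d)%N.
Proof.
elim: k a => [|k IHk] a /=; first by move=> ->; rewrite mdeg0.
by move=> [b [c [/M_deg b_d /IHk c_d ->]]]; rewrite mdegD b_d c_d.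
Qed.

Lemma lem_mdeg_eq a b : (a <= b)%MM -> mdeg a = mdeg b -> a = b.
Proof.
move=> ab e; have h := submK ab; rewrite -h in e; rewrite -h.
move: e; rewrite mdegD => /eqP; rewrite -[X in X == _]add0n eqn_add2r eq_sym.
by rewrite mdeg_eq0 => /eqP ->; rewrite add0m.
Qed.

Lemma lem_mdeg a b : (a <= b)%MM -> (mdeg a <= mdeg b)%N.
Proof. by move=> /submK <-; rewrite mdegD leq_addl. Qed.

Lemma monideal_mdeg f m : monideal M f -> m \in msupp f -> (d <= mdeg m)%N.
Proof. by move=> /monidealP h /h [a /M_deg <-]; exact: lem_mdeg. Qed.

Lemma monideal_mdeg_eq m : mdeg m = d -> monideal M 'X_[m] -> M m.
Proof.
move=> md /monidealX [a Ma am].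
by rewrite -(lem_mdeg_eq am) // (M_deg Ma) md.
Qed.

(** The other terms of [c] raise the degree of the monomials of [f], which is
    already at least [d]. *)
Lemma mcoeffM_initial c f m : monideal M f -> mdeg m = d ->
  (c * f)@_m = c@_0 * f@_m.
Proof.
move=> If md; have cE : c = (c@_0)%:MP + (c - (c@_0)%:MP) by rewrite addrC subrK.
rewrite {1}cE mulrDl mcoeffD mcoeffCM [X in _ + X](_ : _ = 0) ?addr0 //.
apply: memN_msupp_eq0; apply/negP => /msuppM_le /allpairsP [[m1 m2] /= [m1c m2f mE]].
have := monideal_mdeg If m2f; have := md; rewrite mE mdegD => e le_d.
have m10 : m1 = 0%MM by apply/eqP; rewrite -mdeg_eq0; lia.
by move: m1c; rewrite m10 mcoeff_msupp mcoeffB mcoeffC eqxx mulr1 subrr eqxx.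
Qed.

End Equigenerated.

(** Taking the coefficients of the [s] expresses an identity matrix of size
    [size s] as a product through any generating system. *)
Lemma mu_monideal (s : seq mon) d : uniq s -> (forall a, a \in s -> mdeg a = d) ->
  mu (monideal [set` s]) (size s).
Proof.
move=> us sd; split.
  exists [seq 'X_[a] | a <- s]; rewrite size_map; split=> //.
  congr ideal_gen; apply/seteqP; split=> [_ [a /= sa <-]|f /= /mapP [a sa ->]].
    exact: map_f.
  by exists a.
move=> t It.
have /choice [c cE] : forall a, exists c : nat -> S,
    a \in s -> 'X_[a] = \sum_(j < size t) c j * t`_j.
  move=> a; have [sa|] := boolP (a \in s); last by exists (fun=> 0).
  have [|c cE] := @ideal_gen_sumP _ t ('X_[a] : S); last by exists c.
  by rewrite -It; apply: ideal_gen_sub; exists a.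
pose mn i := nth 0%MM s i.
have mns (i : 'I_(size s)) : mn i \in s by apply: mem_nth.
pose U : 'M[K]_(size s, size t) := \matrix_(i, j) (c (mn i) j)@_0.
pose V : 'M[K]_(size t, size s) := \matrix_(j, k) (t`_j)@_(mn k).
apply: (@mulmx1_min _ _ _ U V); apply/matrixP => i k; rewrite !mxE.
have := congr1 (mcoeff (mn k)) (cE (mn i) (mns i)).
rewrite mcoeffX raddf_sum /= nth_uniq // => ->.
apply: eq_bigr => j _; rewrite !mxE (@mcoeffM_initial [set` s] d) //.
- by rewrite It; apply: ideal_gen_sub => /=; apply: mem_nth.
- exact: sd.
Qed.

Lemma mu_unique (A : comNzRingType) (J : set A) p q : mu J p -> mu J q -> p = q.
Proof.
case=> [[s [ss Js]] hs] [[t [st Jt]] ht].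
by apply/eqP; rewrite eqn_leq -{1}st -{2}ss hs // ht.
Qed.

(** A monomial in a homogeneous generator of degree [d] is a multiple of a
    monomial of the ideal; the latter has degree at least [d], since the
    homogeneous generators do, and so the two are equal. *)
Lemma equigenerated_monideal (I : set S) d : monomial_ideal I -> equigenerated I d ->
  exists s : seq mon, [/\ uniq s, forall a, a \in s -> mdeg a = d &
                          I = monideal [set` s]].
Proof.
move=> [M IM] [t [[It _] t_homog]].
have idI : is_ideal I by rewrite IM; apply: monideal_ideal.
have I_deg f m : I f -> m \in msupp f -> (d <= mdeg m)%N.
  pose Q : set S := [set f | forall m, m \in msupp f -> (d <= mdeg m)%N].
  move=> If; suff : Q f by apply.
  move: If; rewrite It; apply; last first.
    by move=> g /= gt m' /(dhomog_mf (t_homog _ gt)) <-.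
  split=> [m'|x y Qx Qy m'|c x Qx m'].
  - by rewrite msupp0.
  - by move=> /msuppD_le; rewrite mem_cat => /orP [/Qx|/Qy].
  - move=> /msuppM_le /allpairsP [[m1 m2] /= [_ /Qx le_d ->]].
    by rewrite mdegD (leq_trans le_d) // leq_addl.
pose s := [seq bmnm m | m : 'X_{1..n < d.+1} <- enum {: 'X_{1..n < d.+1}} &
            (mdeg m == d) && `[< I 'X_[m] >]].
have sP a : a \in s <-> mdeg a = d /\ I 'X_[a].
  split=> [/mapP [m]|[ad Ia]].
    by rewrite mem_filter => /andP [/andP [/eqP md /asboolP Im] _] ->.
  apply/mapP; have lta : (mdeg a < d.+1)%N by rewrite ad.
  exists (BMultinom lta) => //; rewrite mem_filter mem_enum andbT /= ad eqxx /=.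
  exact/asboolP.
exists s; split; [|by move=> a /sP []|].
  by rewrite map_inj_uniq; [exact/filter_uniq/enum_uniq|exact: val_inj].
apply/seteqP; split.
  rewrite {1}It; apply: ideal_gen_min; first exact: monideal_ideal.
  move=> f /= ft; have If : I f by rewrite It; apply: ideal_gen_sub.
  apply/monidealP => m mf; exists m; last exact: lepm_refl.
  have md := dhomog_mf (t_homog _ ft) mf; apply/sP; split=> //.
  move: (If); rewrite IM => /monidealP /(_ m mf) [a Ma am].
  have Ia : I 'X_[a] by rewrite IM; apply: ideal_gen_sub; exists a.
  suff <- : a = m by rewrite -IM.
  apply: lem_mdeg_eq => //; apply/eqP; rewrite eqn_leq lem_mdeg // md.
  by apply: I_deg Ia _; rewrite msuppX inE.
by apply: ideal_gen_min => // _ [a /sP [_ ?] <-].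
Qed.

End MonomialIdeals.

(** * Regular sequences of polynomials in separate variables *)

Section Univariate.
Variables (K : fieldType) (n : nat).
Local Notation S := {mpoly K[n]}.
Implicit Types (f u : S) (i j : 'I_n).

Definition isolate i : {rmorphism S -> {poly S}} :=
  mmap (polyC \o @mpolyC n K) (fun j => if j == i then 'X else ('X_j)%:P).

Definition in_var i (h : {poly K}) : S := (map_poly (@mpolyC n K) h).['X_i].

Lemma isolateX i j : isolate i 'X_j = if j == i then 'X else ('X_j)%:P.
Proof. by rewrite /= mmapX mmap1U. Qed.

Lemma isolateC i c : isolate i c%:MP = (c%:MP)%:P.
Proof. by rewrite /= mmapC. Qed.

Lemma isolateK i f : (isolate i f).['X_i] = f.
Proof.
rewrite [in RHS](mpolyE f) {1}(mpolyE f) rmorph_sum horner_sum.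
apply: eq_bigr => m _; rewrite -mul_mpolyC rmorphM isolateC hornerM hornerC.
congr (_ * _); rewrite mpolyXE_id rmorph_prod horner_prod.
apply: eq_bigr => j _; rewrite rmorphXn horner_exp isolateX.
by case: eqVneq => [->|_]; rewrite ?hornerX ?hornerC.
Qed.

Lemma isolate_in_var i h : isolate i (in_var i h) = map_poly (@mpolyC n K) h.
Proof.
rewrite /in_var -horner_map isolateX eqxx -map_poly_comp /=.
rewrite -[RHS]comp_polyXr /comp_poly -map_poly_comp; congr (_.['X]).
by apply: eq_map_poly => c; exact: isolateC.
Qed.

Lemma isolate_other i j h : j != i -> isolate i (in_var j h) = (in_var j h)%:P.
Proof.
move=> ji; rewrite /in_var -horner_map isolateX (negbTE ji) -map_poly_comp.
rewrite -[RHS]horner_map -map_poly_comp; congr (_.[_]).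
by apply: eq_map_poly => c; exact: isolateC.
Qed.

Variable h : 'I_n -> {poly K}.
Hypothesis h_monic : forall i, h i \is monic.
Local Notation w i := (in_var i (h i)).
Local Notation H i := (map_poly (@mpolyC n K) (h i)).

Let H_unit i : lead_coef (H i) \is a GRing.unit.
Proof. by rewrite lead_coef_map (monicP (h_monic i)) rmorph1 unitr1. Qed.

Let H_monic i : H i \is monic.
Proof. by rewrite map_monic. Qed.

(** The remainder of the division of [f] by [h i], as a polynomial in the
    variable [i] over the other ones. *)
Definition remainder i f : S := (modp (isolate i f) (H i)).['X_i].

Lemma remainderD i f u : remainder i (f + u) = remainder i f + remainder i u.
Proof. by rewrite /remainder rmorphD Pdiv.IdomainUnit.modpD // hornerD. Qed.

Lemma remainder0 i : remainder i 0 = 0.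
Proof. by rewrite /remainder rmorph0 mod0p horner0. Qed.

Lemma remainder_self i f : remainder i (w i * f) = 0.
Proof. by rewrite /remainder rmorphM isolate_in_var modp_mulr horner0. Qed.

Lemma remainder_other i j f : j != i -> remainder i (w j * f) = w j * remainder i f.
Proof.
move=> ji; rewrite /remainder rmorphM isolate_other // mul_polyC.
by rewrite Pdiv.IdomainUnit.modpZl // hornerZ.
Qed.

Lemma remainder_quotient i f : exists q, f = q * w i + remainder i f.
Proof.
exists (divp (isolate i f) (H i)).['X_i].
rewrite -[LHS](isolateK i) /remainder /in_var -hornerM -hornerD.
congr (_.[_]); have := Pdiv.Idomain.divp_eq (isolate i f) (H i).
by rewrite (monicP (H_monic i)) expr1n scale1r.
Qed.

Definition remainders (r : seq 'I_n) f := foldr remainder f r.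

Lemma remaindersD r f u : remainders r (f + u) = remainders r f + remainders r u.
Proof. by elim: r => //= i r ->; rewrite remainderD. Qed.

Lemma remainders0 r : remainders r 0 = 0.
Proof. by elim: r => //= i r ->; rewrite remainder0. Qed.

Lemma remainders_other r i f : i \notin r ->
  remainders r (w i * f) = w i * remainders r f.
Proof.
elim: r => //= j r IHr; rewrite inE negb_or => /andP [ij /IHr ->].
by rewrite remainder_other.
Qed.

Lemma remainders_mem r i f : i \in r -> remainders r (w i * f) = 0.
Proof.
elim: r => //= j r IHr; have [/IHr ->|ir] := boolP (i \in r).
  by rewrite remainder0.
rewrite inE (negbTE ir) orbF => /eqP ij.
by rewrite remainders_other // ij remainder_self.
Qed.

Lemma remainders_mod r f : ideal_gen [set` [seq w i | i <- r]] (f - remainders r f).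
Proof.
have id_gen s := ideal_gen_is_ideal [set` s : seq S].
elim: r => [|i r IHr] /=; first by rewrite subrr; apply: (ideal0 (id_gen _)).
have [q qE] := remainder_quotient i (remainders r f).
have -> : f - remainder i (remainders r f) = (f - remainders r f) + q * w i.
  by rewrite {2}qE opprD addrA addrAC subrK.
apply: (idealD (id_gen _)).
  apply: (ideal_gen_min (id_gen _)) IHr => x xr.
  by apply: ideal_gen_sub; rewrite /= inE [x \in _]xr orbT.
apply: (idealM (id_gen _)); apply: ideal_gen_sub.
by rewrite /= inE eqxx.
Qed.

Lemma remainders_eq0 r f :
  ideal_gen [set` [seq w i | i <- r]] f <-> remainders r f = 0.
Proof.
split=> [|r0]; last by have := @remainders_mod r f; rewrite r0 subr0.
move=> /ideal_gen_sumP [c ->]; rewrite size_map.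
rewrite (big_morph _ (remaindersD r) (remainders0 r)) big1 // => j _.
have i0 := tnth (in_tuple r) j; rewrite (nth_map i0) // mulrC.
by apply: remainders_mem; apply: mem_nth.
Qed.

(** Division by the [h j] is linear over the polynomials in the other
    variables, so multiplication by [w i] commutes with taking remainders, and
    it is injective on them. *)
Lemma univariate_regular r i f : i \notin r ->
  ideal_gen [set` [seq w j | j <- r]] (w i * f) ->
  ideal_gen [set` [seq w j | j <- r]] f.
Proof.
move=> ir /remainders_eq0; rewrite remainders_other // => /eqP.
rewrite mulf_eq0 => /orP [/eqP w0|/eqP r0]; last exact/remainders_eq0.
have := isolate_in_var i (h i); rewrite w0 rmorph0 => /esym/eqP.
by rewrite (negbTE (monic_neq0 (H_monic i))).
Qed.

End Univariate.

(** * The fiber cone as a ring of polynomials *)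

Section FromCoefficients.
Variables (K : fieldType) (n : nat).

Definition mpoly_of (E : 'X_{1..n} -> K) (N : nat) : {mpoly K[n]} :=
  \sum_(m : 'X_{1..n < N}) E m *: 'X_[m].

Lemma mcoeff_mpoly_of E N : (forall m, (N <= mdeg m)%N -> E m = 0) ->
  forall m, (mpoly_of E N)@_m = E m.
Proof.
move=> hE m; have [/(mcoeff_mpoly E)|lem] := ltnP (mdeg m) N; first exact.
rewrite hE // raddf_sum big1 // => b _.
rewrite /= mcoeffZ mcoeffX; case: eqP => [e|_]; rewrite ?mulr0 //.
by have := bmdeg b; rewrite e ltnNge lem.
Qed.

Lemma mcoeff_ge_msize (f : {mpoly K[n]}) m : (msize f <= mdeg m)%N -> f@_m = 0.
Proof. by move=> h; apply: memN_msupp_eq0; apply: msize_mdeg_ge. Qed.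

End FromCoefficients.

Section FiberEmbedding.
Variables (K : fieldType) (n d : nat) (M : set 'X_{1..n}).
Local Notation S := {mpoly K[n]}.
Hypotheses (d_gt0 : (0 < d)%N) (M_deg : forall a, M a -> mdeg a = d).
Local Notation I := (@monideal K n M).
Local Notation "f '`@' k" := ((rees_val f)`_k : S) (at level 2).

Let rees_pow (f : rees I) k : monideal (mpow M k) (f`@k).
Proof.
by rewrite -monideal_pow; case: f => f hf /=; move: hf => /asboolP; apply.
Qed.

Let rees_mdeg (f : rees I) k m : (f`@k)@_m != 0 -> (k * d <= mdeg m)%N.
Proof.
rewrite -mcoeff_msupp.
exact: (monideal_mdeg (@mdeg_mpow _ M d M_deg k) (@rees_pow f k)).
Qed.

(** The component of degree [k * d] of the coefficient of [t ^ k] is what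
    survives modulo the maximal ideal; as [d > 0] these components can be added
    up without losing [k]. *)
Definition initial_part (f : rees I) : S :=
  mpoly_of (fun m => if (d %| mdeg m)%N then (f`@(mdeg m %/ d)%N)@_m else 0)
    (size (rees_val f) * d).

Lemma mcoeff_initial f m : (initial_part f)@_m =
  if (d %| mdeg m)%N then (f`@(mdeg m %/ d)%N)@_m else 0.
Proof.
apply: mcoeff_mpoly_of => m' le_m'; case: ifP => // _.
by rewrite nth_default ?mcoeff0 // leq_divRL.
Qed.

Lemma initial_partB : zmod_morphism initial_part.
Proof.
move=> f g; apply/mpolyP => m; rewrite mcoeffB !mcoeff_initial /=.
by case: ifP => _; rewrite ?subr0 // coefB mcoeffB.
Qed.

Lemma initial_part1 : initial_part 1 = 1.
Proof.
apply/mpolyP => m; rewrite mcoeff_initial /= coef1 mcoeff1.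
have [->|m0] := eqVneq m 0%MM; first by rewrite mdeg0 dvdn0 div0n mcoeff1 eqxx.
case: ifP => // dm; rewrite -[(mdeg m %/ d == 0)%N]negbK -lt0n divn_gt0 //.
by rewrite dvdn_leq ?mcoeff0 // lt0n mdeg_eq0.
Qed.

Lemma initial_partM f g : initial_part (f * g) = initial_part f * initial_part g.
Proof.
apply/mpolyP => m; rewrite mcoeffM mcoeff_initial.
case: ifP => [dm|ndm]; last first.
  rewrite big1 // => -[[m1 _] [m2 _]] /= /eqP /(congr1 mdeg).
  rewrite mdegD !mcoeff_initial => mE.
  case: ifP => d1; last by rewrite mul0r.
  case: ifP => d2; last by rewrite mulr0.
  by move: ndm; rewrite mE dvdn_add.
rewrite /= coefM raddf_sum /=.
under eq_bigr => i _ do rewrite mcoeffM.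
rewrite exchange_big /=; apply: eq_bigr => -[[m1 _] [m2 _]] /= /eqP.
move=> /(congr1 mdeg); rewrite mdegD => mE.
rewrite !mcoeff_initial.
pose k := (mdeg m %/ d)%N; have mk : mdeg m = (k * d)%N by rewrite divnK.
have mD : (mdeg m1 + mdeg m2 = k * d)%N by rewrite -mk.
have zero (i : 'I_k.+1) : mdeg m1 != (i * d)%N ->
    (f`@i)@_m1 * (g`@(k - i)%N)@_m2 = 0.
  move=> ne; apply/eqP; rewrite mulf_eq0; apply: contraT.
    rewrite negb_or => /andP [/rees_mdeg h1 /rees_mdeg h2].
  have : (i * d + (k - i) * d = k * d)%N.
    by rewrite -mulnDl subnKC // -ltnS.
  move: ne h1 h2 mD; lia.
have [d1|nd1] := boolP (d %| mdeg m1)%N; last first.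
  rewrite mul0r big1 // => i _; apply: zero.
  by apply: contraNneq nd1 => ->; rewrite dvdn_mull.
have d2 : (d %| mdeg m2)%N by rewrite -(dvdn_addr _ d1) mD dvdn_mull.
rewrite d2; pose i1 := (mdeg m1 %/ d)%N.
have lt1 : (i1 < k.+1)%N by rewrite ltnS leq_div2r // mE leq_addr.
rewrite (bigD1 (Ordinal lt1)) //= big1 ?addr0; last first.
  move=> i; rewrite -val_eqE /= => ne; apply: zero; apply: contraNneq ne => e.
  by rewrite /i1 e mulnK.
congr (_ * (_`@_)@_m2).
by rewrite /i1 mE divnDl // addKn.
Qed.

(** A monomial of [I^k] of degree above [k * d] is a proper multiple of a
    generator of [I^k], hence belongs to the product with the maximal ideal. *)
Lemma initial_part_eq0 (f : rees I) :
  (f \in @fiber_ideal K n I) = (initial_part f == 0).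
Proof.
have mul_max k : ideal_mul (@max_ideal K n) (ideal_pow I k) =
    monideal (madd [set U_(i)%MM | i in [set: 'I_n]] (mpow M k)).
  rewrite monideal_pow -monideal_mul; congr (ideal_mul _ _).
  congr ideal_gen; apply/seteqP; split=> [_ [i _ <-]|_ [_ [i _ <-] <-]].
    by exists U_(i)%MM => //; exists i.
  by exists i.
apply/asboolP/eqP => [hf|f0 k].
  apply/mpolyP => m; rewrite mcoeff_initial mcoeff0; case: ifP => // dm.
  apply: memN_msupp_eq0; apply/negP => mf.
  move: (hf (mdeg m %/ d)%N); rewrite mul_max => /monidealP /(_ m mf).
  move=> [_ [_ [b [[i _ <-] /(mdeg_mpow M_deg) hb ->]]]] /lem_mdeg.
  by rewrite mdegD mdeg1 hb divnK // ltnn.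
rewrite mul_max; apply/monidealP => m mf.
have /monidealP /(_ m mf) [b Mb bm] := @rees_pow f k.
have bd := mdeg_mpow M_deg Mb.
have : b != m.
  apply: contraTneq mf => e; subst b; rewrite mcoeff_msupp negbK.
  have := congr1 (mcoeff m) f0; rewrite mcoeff_initial mcoeff0 bd.
  by rewrite dvdn_mull // mulnK // => ->.
move=> ne; have : (m - b)%MM != 0%MM.
  by apply: contraNneq ne => e; rewrite -(submK bm) e add0m.
have [i hi|hi] := pickP (fun i => (m - b)%MM i != 0%N); last first.
  move=> /eqP h; exfalso; apply: h; apply/mnmP => i; rewrite mnm0E; apply/eqP.
  by rewrite -[_ == _]negbK hi.
move=> _; exists (U_(i) + b)%MM; first by exists U_(i)%MM, b; split=> //; exists i.
apply/mnm_lepP => j; rewrite mnmDE mnm1E; have /mnm_lepP /(_ j) := bm.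
by move: hi; rewrite mnmBE; case: (i =P j) => [<-|_]; lia.
Qed.

Definition fiber_embed (x : fiber_cone I) : S := initial_part (repr x).

Lemma fiber_embed_pi f : fiber_embed (\pi_(fiber_cone I) f) = initial_part f.
Proof.
apply/eqP; rewrite -subr_eq0 -initial_partB -initial_part_eq0.
by rewrite Quotient.idealrBE reprK.
Qed.

Lemma fiber_embedB : zmod_morphism fiber_embed.
Proof.
move=> x y; rewrite -[x]reprK -[y]reprK -rmorphB !fiber_embed_pi.
exact: initial_partB.
Qed.

Lemma fiber_embedM : monoid_morphism fiber_embed.
Proof.
split=> [|x y].
  by rewrite -(rmorph1 \pi_(fiber_cone I)) fiber_embed_pi initial_part1.
rewrite -[x]reprK -[y]reprK -rmorphM !fiber_embed_pi.
exact: initial_partM.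
Qed.

HB.instance Definition _ :=
  GRing.isZmodMorphism.Build (fiber_cone I) S fiber_embed fiber_embedB.
HB.instance Definition _ :=
  GRing.isMonoidMorphism.Build (fiber_cone I) S fiber_embed fiber_embedM.

Lemma fiber_embed_inj : injective fiber_embed.
Proof.
move=> x y e; have : fiber_embed (x - y) == 0 by rewrite rmorphB /= e subrr.
rewrite /fiber_embed -initial_part_eq0 -[repr _]subr0 Quotient.idealrBE reprK.
by rewrite rmorph0 subr_eq0 => /eqP.
Qed.

Lemma fiber_embed_image g : (exists x, fiber_embed x = g) <->
  (forall m, m \in msupp g -> exists k, mpow M k m).
Proof.
split=> [[x <-] m|hg].
  rewrite -[x]reprK fiber_embed_pi mcoeff_msupp mcoeff_initial.
  set k := (mdeg m %/ d)%N; case: ifP => [dm|_]; last by rewrite eqxx.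
  rewrite -mcoeff_msupp => mf; exists k.
  have /monidealP /(_ m mf) [b Mb bm] := @rees_pow (repr x) k.
  by rewrite -(lem_mdeg_eq bm) // (mdeg_mpow M_deg Mb) divnK.
suff h (r : seq 'X_{1..n}) : {subset r <= msupp g} ->
    exists x, fiber_embed x = \sum_(m <- r) g@_m *: 'X_[m].
  by have [x xE] := h (msupp g) (fun _ => id); exists x; rewrite xE -mpolyE.
elim: r => [|m r IHr] hr; first by exists 0; rewrite big_nil rmorph0.
have [|x xE] := IHr; first by move=> m' m'r; apply: hr; rewrite inE m'r orbT.
have /hg [k Mk] : m \in msupp g by apply: hr; rewrite inE eqxx.
pose p : {poly S} := (g@_m *: 'X_[m])%:P * 'X^k.
have hp : p \in rees_pred I.
  apply/asboolP => j; rewrite coefCM coefXn.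
  have [->|_] := eqVneq j k; last first.
    by rewrite mulr0; exact: (ideal0 (ideal_pow_is_ideal I j)).
  rewrite mulr1 monideal_pow -mul_mpolyC; apply: (idealM (monideal_ideal _ _)).
  by apply: ideal_gen_sub; exists m.
exists (\pi_(fiber_cone I) (Rees hp) + x); rewrite rmorphD /= fiber_embed_pi xE.
rewrite big_cons; congr (_ + _); apply/mpolyP => m'.
rewrite mcoeff_initial /= coefCM coefXn mcoeffZ mcoeffX.
have [<-|ne] := eqVneq m m'.
  by rewrite (mdeg_mpow M_deg Mk) dvdn_mull // mulnK // eqxx mulr1 mcoeffZ mcoeffX eqxx.
rewrite mulr0; case: ifP => // _; case: eqP => _; last by rewrite mulr0 mcoeff0.
by rewrite mulr1 mcoeffZ mcoeffX (negbTE ne) mulr0.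
Qed.

Lemma fiber_cone_embedding : exists f : {rmorphism fiber_cone I -> S},
  injective f /\ forall g, (exists x, f x = g) <->
    (forall m, m \in msupp g -> exists k, mpow M k m).
Proof.
by exists fiber_embed; split; [exact: fiber_embed_inj|exact: fiber_embed_image].
Qed.

End FiberEmbedding.

(** * Coordinate primes: height and dimension *)

Section CoordinatePrimes.
Variables (K : fieldType) (n : nat).
Local Notation S := {mpoly K[n]}.

Lemma mpoly_rmorph_eq (B : comNzRingType) (f g : {rmorphism S -> B}) :
  (forall c, f c%:MP = g c%:MP) -> (forall i, f 'X_i = g 'X_i) -> f =1 g.
Proof.
move=> fC fX p; rewrite [p]mpolyE !rmorph_sum; apply: eq_bigr => m _.
rewrite -mul_mpolyC !rmorphM fC mpolyXE_id !rmorph_prod; congr (_ * _).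
by apply: eq_bigr => i _; rewrite !rmorphXn fX.
Qed.

(** Setting the variables in [V] to zero; the kernel is the prime that these
    variables generate. *)
Definition kill (V : pred 'I_n) : {rmorphism S -> S} :=
  mmap (@mpolyC n K) (fun i => if V i then 0 else 'X_i).

Definition coord_prime V : set S := [set f | kill V f = 0].

Lemma killX V i : kill V 'X_i = if V i then 0 else 'X_i.
Proof. by rewrite /= mmapX mmap1U. Qed.

Lemma killC V c : kill V c%:MP = c%:MP.
Proof. by rewrite /= mmapC. Qed.

Lemma coord_primeE V f : coord_prime V f <-> kill V f = 0.
Proof. by []. Qed.

Lemma coord_prime_prime V : is_prime (coord_prime V).
Proof.
split=> [||x y].
- split=> [|x y|a x].
  + by apply/coord_primeE; rewrite rmorph0.
  + by move=> /coord_primeE Vx /coord_primeE Vy; apply/coord_primeE;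
      rewrite rmorphD Vx Vy addr0.
  + by move=> /coord_primeE Vx; apply/coord_primeE; rewrite rmorphM Vx mulr0.
- by move=> /coord_primeE; rewrite rmorph1 => /eqP; rewrite oner_eq0.
- move=> /coord_primeE; rewrite rmorphM => /eqP.
  by rewrite mulf_eq0 => /orP [] /eqP; [left|right].
Qed.

Lemma coord_prime_sub (V W : pred 'I_n) : (forall i, V i -> W i) ->
  coord_prime V `<=` coord_prime W.
Proof.
move=> VW f /coord_primeE Vf; apply/coord_primeE.
have eqW g : kill W g = kill W (kill V g).
  apply: (@mpoly_rmorph_eq _ (kill W) (kill W \o kill V)) => [c|i].
    by change (kill W c%:MP = kill W (kill V c%:MP)); rewrite !killC.
  change (kill W 'X_i = kill W (kill V 'X_i)); rewrite [kill V _]killX.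
  by case: ifP => // /VW Wi; rewrite rmorph0 killX Wi.
by rewrite eqW Vf rmorph0.
Qed.

Lemma coord_primeX (V : pred 'I_n) (m : 'X_{1..n}) i :
  V i -> m i != 0%N -> coord_prime V 'X_[m].
Proof.
move=> Vi mi; apply/coord_primeE; have h : (U_(i) <= m)%MM by rewrite lep1mP.
by rewrite -(submK h) mpolyXD rmorphM killX Vi mulr0.
Qed.

Lemma coord_primeXn (V : pred 'I_n) i k : ~~ V i -> ~ coord_prime V ('X_i ^+ k).
Proof.
move=> Vi /coord_primeE; rewrite rmorphXn killX (negbTE Vi) => /eqP.
rewrite expf_eq0 => /andP [_ /eqP /(congr1 (mcoeff U_(i)%MM))].
by rewrite mcoeffX mcoeff0 eqxx => /eqP; rewrite oner_eq0.
Qed.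

(** Otherwise each generator involves a variable other than [i], and the ideal
    lies in the prime generated by these variables. Chains of primes ending
    there extend to the ideal of all variables, so its height is less than
    [n]. *)
Lemma height_pure_power (s : seq 'X_{1..n}) d i :
    (forall a, a \in s -> mdeg a = d) -> height (@monideal K n [set` s]) n ->
  (U_(i) *+ d)%MM \in s.
Proof.
move=> sd [_ min_height]; apply/negPn/negP => nis.
pose V := fun j : 'I_n => j != i.
have IV : @monideal K n [set` s] `<=` coord_prime V.
  apply: ideal_gen_min; first by case: (coord_prime_prime V).
  move=> _ [a /= sa <-].
  have [j /andP [ji aj]|no] := pickP (fun j => (j != i) && (a j != 0%N)).
    exact: (@coord_primeX V a j).
  exfalso; move/negP: nis; apply; suff <- : a = (U_(i) *+ d)%MM by [].
  have ai j : j != i -> a j = 0%N.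
    by move=> ji; have := no j; rewrite ji /= => /negbFE /eqP.
  have <- : a i = d by rewrite -(sd _ sa) mdegE (bigD1 i) //= big1 ?addn0.
  apply/mnmP => j; rewrite mulmnE mnm1E eq_sym.
  by have [->|/ai ->] := eqVneq j i; rewrite ?mul1n ?mul0n.
have bound k : [set r | exists P : nat -> set S,
    prime_chain P r /\ P r = coord_prime V] k -> (k < n)%N.
  move=> [P [[pP sP] Pk]].
  pose P' j := if (j <= k)%N then P j else coord_prime predT.
  apply: (@embedded_chain_le K n S (@mpolyC n K) idfun _ _ P') => //; split=> j jk.
    by rewrite /P'; case: ifP => // h; [apply: pP|apply: coord_prime_prime].
  rewrite /P'; rewrite ltnS in jk; rewrite jk; case: ifP => [|h]; first exact: sP.
  have -> : j = k by apply/eqP; rewrite eqn_leq jk leqNgt h.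
  rewrite Pk; split; first by apply: coord_prime_sub.
  move=> /(_ ('X_i ^+ 1)) h1; apply: (@coord_primeXn V i 1); first by rewrite /V eqxx.
  by apply: h1; rewrite expr1; apply: (@coord_primeX predT _ i); rewrite // mnm1E eqxx.
have [||k kmax _] := is_max_exists (b := n) (X :=
  [set r | exists P : nat -> set S, prime_chain P r /\ P r = coord_prime V]).
- exists 0%N, (fun=> coord_prime V); split=> //; split=> //.
  by move=> j _; apply: coord_prime_prime.
- by move=> k /bound /ltnW.
have := min_height _ _ (coord_prime_prime V) IV kmax.
by rewrite leqNgt bound //; case: kmax.
Qed.

End CoordinatePrimes.

Lemma prime_preimage (A B : comNzRingType) (f : {rmorphism A -> B}) (Q : set B) :
  is_prime Q -> is_prime (f @^-1` Q).
Proof.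
move=> [idQ Q1 QM]; split=> [||x y] /=; last by rewrite rmorphM; apply: QM.
  split=> [|x y Qx Qy|a x Qx] /=; first by rewrite rmorph0; apply: ideal0.
    by rewrite rmorphD; apply: idealD.
  by rewrite rmorphM; apply: idealM.
by rewrite /preimage /= rmorph1.
Qed.

(** The traces of the primes generated by the first variables are told apart
    by the pure powers. *)
Lemma embedded_krull_dim (K : fieldType) n d (A : comNzRingType)
    (phi : {rmorphism K -> A}) (f : {rmorphism A -> {mpoly K[n]}}) :
    injective f -> (forall c, f (phi c) = c%:MP) -> (0 < d)%N ->
    (forall i, exists y, f y = 'X_i ^+ d) ->
  krull_dim A n.
Proof.
move=> f_inj fphi d0 fX; split; last first.
  by move=> k [P /(embedded_chain_le f_inj fphi)].
exists (fun k => f @^-1` @coord_prime K n (fun j : 'I_n => (j < k)%N)); split=> k kn.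
  by apply: prime_preimage; apply: coord_prime_prime.
split.
  by move=> y /=; apply: coord_prime_sub => j; apply: ltnW.
have [y yE] := fX (Ordinal kn); move=> /(_ y) /=.
rewrite yE => h; apply: (@coord_primeXn K n (fun j : 'I_n => (j < k)%N) (Ordinal kn) d).
  by rewrite /= ltnn.
apply: h; rewrite mpolyXn; apply: (@coord_primeX _ _ _ _ (Ordinal kn)).
  exact: leqnn.
by rewrite mulmnE mnm1E eqxx mul1n -lt0n.
Qed.

(** * Maximal ideals of finitely generated algebras *)

Section ResidueField.
Variables (A : comNzRingType) (P : set A) (P_max : is_maximal P).

Definition max_pred of is_maximal P : {pred A} := fun x => `[< P x >].
Local Notation p := (max_pred P_max).

Lemma max_pred_closed : idealr_closed p.
Proof.
have [idP P1 _] := P_max; split=> [||a u v /asboolP Pu /asboolP Pv].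
- by apply/asboolP; apply: ideal0.
- by apply/asboolP.
- by apply/asboolP; apply: idealD => //; apply: idealM.
Qed.

HB.instance Definition _ := isIdealr.Build A p max_pred_closed.

Definition residue := {ideal_quot p}.
HB.instance Definition _ := GRing.ComNzRing.on residue.

Lemma residue_eq0 a : (\pi_residue a == 0) = `[< P a >].
Proof. by rewrite -(rmorph0 \pi_residue) -Quotient.idealrBE subr0. Qed.

Lemma residue_inv (x : residue) : x != 0 -> exists y, y * x = 1.
Proof.
have [idP P1 maxP] := P_max.
rewrite -[x]reprK; move: (repr x) => a; rewrite residue_eq0 => /asboolP Pa.
pose Q : set A := [set z | exists u b, P u /\ z = u + b * a].
have idQ : is_ideal Q.
  split=> [|_ _ [u [b [Pu ->]]] [u' [b' [Pu' ->]]]|c _ [u [b [Pu ->]]]].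
  - by exists 0, 0; rewrite mul0r addr0; split=> //; apply: ideal0.
  - by exists (u + u'), (b + b'); rewrite mulrDl addrACA; split=> //; apply: idealD.
  - by exists (c * u), (c * b); rewrite mulrDr mulrA; split=> //; apply: idealM.
have PQ : P `<=` Q by move=> u Pu; exists u, 0; rewrite mul0r addr0.
have [[u [b [Pu e]]]|Q1] := pselect (Q 1).
  exists (\pi_residue b); rewrite -rmorphM.
  have /eqP u0 : \pi_residue u == 0 by rewrite residue_eq0; apply/asboolP.
  have := congr1 \pi_residue e; rewrite rmorph1 rmorphD /= u0 add0r => e1.
  exact: esym e1.
exfalso; apply: Pa; rewrite -(maxP Q idQ Q1 PQ); exists 0, 1.
by rewrite add0r mul1r; split=> //; apply: ideal0.
Qed.

Definition res_inv (x : residue) : residue := xget 0 [set y | y * x = 1].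

Lemma res_mulVf x : x != 0 -> res_inv x * x = 1.
Proof. by move=> /residue_inv [y yx]; rewrite /res_inv; case: xgetP => // /(_ y). Qed.

Lemma res_inv0 : res_inv 0 = 0.
Proof.
rewrite /res_inv; case: xgetP => // y _ /= /eqP.
by rewrite mulr0 eq_sym oner_eq0.
Qed.

HB.instance Definition _ := GRing.ComNzRing_isField.Build residue res_mulVf res_inv0.

(** By Zariski's lemma the residue field is algebraic over [K], so a maximal
    ideal contains a monic polynomial in each generator. *)
Lemma maximal_ideal_algebraic (K : fieldType) (phi : {rmorphism K -> A}) s
    (y : nat -> A) : (forall x, exists q, teval phi s.+1 y q = x) ->
  exists2 g : {poly K}, g \is monic & P (map_poly phi g).[y s].
Proof.
move=> surj; pose pi : {rmorphism A -> residue} := \pi_residue.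
have [|g [g0 gy]] := @zariski K residue (pi \o phi) s (pi \o y).
  move=> x; have [q qE] := surj (repr x); exists q.
  by rewrite -(rmorph_teval (phi := phi) (f := pi)) // qE /pi /= reprK.
exists ((lead_coef g)^-1 *: g).
  have g0' : g != 0 by apply: contraNneq g0 => ->; rewrite rmorph0.
  by rewrite monicE lead_coefZ mulVf // lead_coef_eq0.
apply/asboolP; rewrite -residue_eq0 linearZ /= hornerZ rmorphM /=.
rewrite -[\pi_residue (_.[_])]horner_map /= -map_poly_comp.
by rewrite [X in _ * X]gy mulr0.
Qed.

End ResidueField.

(** * Cohen--Macaulayness *)

Section TowerImage.
Variables (K A : comNzRingType) (phi : {rmorphism K -> A}).

Lemma teval_const s y c : exists q, teval phi s y q = phi c.
Proof.
elim: s y => [|s IHs] y; first by exists c.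
by have [q qE] := IHs (y \o S); exists (q%:P); rewrite /= horner_morphC.
Qed.

Lemma teval_var s y j : (j < s)%N -> exists q, teval phi s y q = y j.
Proof.
elim: s y j => // s IHs y [_|j js]; first by exists 'X; rewrite /= horner_morphX.
by have [q qE] := IHs (y \o S) j js; exists (q%:P); rewrite /= horner_morphC.
Qed.

End TowerImage.

Section PurePowerReduction.
Variables (K : fieldType) (n d : nat) (M : set 'X_{1..n}).
Local Notation S := {mpoly K[n]}.
Local Notation pure i := (U_(i) *+ d)%MM.
Hypotheses (d_gt0 : (0 < d)%N) (M_deg : forall a, M a -> mdeg a = d).
Hypothesis M_pure : forall i, M (pure i).
Hypothesis M_red : forall a b, M a -> M b ->
  exists i c, M c /\ (a + b = pure i + c)%MM.

Definition powers : set 'X_{1..n} := [set m | exists k, mpow M k m].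

Let E : set 'X_{1..n} := [set pure i | i in [set: 'I_n]].

Let addmCA (a b c : 'X_{1..n}) : (a + (b + c) = b + (a + c))%MM.
Proof. by rewrite !addmA [(a + b)%MM]addmC. Qed.

Let pure_sub k e : mpow E k e -> mpow M k e.
Proof.
elim: k e => //= k IHk e [_ [e' [[i _ <-] /IHk he' ->]]].
by exists (pure i), e'.
Qed.

Let mpow_red k m : mpow M k.+1 m -> exists a e, [/\ M a, mpow E k e & m = (a + e)%MM].
Proof.
elim: k m => [|k IHk] m; first by move=> [a [_ [Ma -> ->]]]; exists a, 0%MM.
move=> [a [m' [Ma /IHk [b [e [Mb he ->]]] ->]]].
have [i [c [Mc abE]]] := M_red Ma Mb.
exists c, (pure i + e)%MM; split=> //.
  by exists (pure i), e; split=> //; exists i.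
by rewrite addmA abE -addmA addmCA.
Qed.

Let pure_split k e i : mpow E k e ->
  e i = 0%N \/ exists k' e', mpow E k' e' /\ e = (pure i + e')%MM.
Proof.
elim: k e => [|k IHk] e /=; first by move=> ->; left; rewrite mnm0E.
move=> [_ [e' [[j _ <-] he' ->]]].
have [->|ne] := eqVneq j i; first by right; exists k, e'.
have [e0|[k' [e'' [he'' ->]]]] := IHk e' he'.
  by left; rewrite mnmDE e0 mulmnE mnm1E (negbTE ne).
right; exists k'.+1, (pure j + e'')%MM; split; last by rewrite addmCA.
by exists (pure j), e''; split=> //; exists j.
Qed.

(** An element of degree [k.+1] in the monoid is [a + e] with [a] in [M] and
    [e] a sum of pure powers. If [pure i] is not one of the latter, then it
    divides [a], and is equal to it because both have degree [d]. *)
Lemma powers_cancel m i : powers (m + pure i)%MM <-> powers m.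
Proof.
split=> [[[|k]] /=|[k mk]]; last first.
- by exists k.+1; exists (pure i), m; rewrite addmC.
- move=> /mpow_red [a [e [Ma he mE]]].
  have [e0|[k' [e' [he' eE]]]] := pure_split i he; last first.
    exists k'.+1, a, e'; split=> //; first exact: pure_sub.
    by apply: (@addIm _ (pure i)); rewrite mE eE -addmA [(e' + _)%MM]addmC.
  have aE : pure i = a.
    apply: lem_mdeg_eq; last by rewrite mdegMn mdeg1 mul1n M_deg.
    apply/mnm_lepP => j; rewrite mulmnE mnm1E; case: eqP => // <-.
    have := congr1 (fun u : 'X_{1..n} => u i) mE.
    by rewrite !mnmDE e0 mulmnE mnm1E eqxx; lia.
  exists k; apply: pure_sub; suff -> : m = e by [].
  by apply: (@addIm _ (pure i)); rewrite mE -aE addmC.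
- move=> /(congr1 (fun u : 'X_{1..n} => u i)); rewrite mnmDE mulmnE mnm1E mnm0E eqxx.
  lia.
Qed.

Definition retract (f : S) : S :=
  mpoly_of (fun m => if `[< powers m >] then f@_m else 0) (msize f).

Lemma mcoeff_retract f m : (retract f)@_m = if `[< powers m >] then f@_m else 0.
Proof.
by apply: mcoeff_mpoly_of => m' h; case: ifP => // _; apply: mcoeff_ge_msize.
Qed.

Lemma retractD f g : retract (f + g) = retract f + retract g.
Proof.
apply/mpolyP => m; rewrite mcoeffD !mcoeff_retract mcoeffD.
by case: ifP; rewrite ?addr0.
Qed.

Lemma retract0 : retract 0 = 0.
Proof. by apply/mpolyP => m; rewrite mcoeff_retract mcoeff0; case: ifP. Qed.

Lemma retract_supp f m : m \in msupp (retract f) -> powers m.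
Proof. by rewrite mcoeff_msupp mcoeff_retract; case: asboolP; rewrite ?eqxx. Qed.

Lemma retract_id f : (forall m, m \in msupp f -> powers m) -> retract f = f.
Proof.
move=> fp; apply/mpolyP => m; rewrite mcoeff_retract; case: asboolP => // nm.
by apply/esym/memN_msupp_eq0/negP => /fp.
Qed.

Lemma mcoeffMX_sub (f : S) a m :
  (f * 'X_[a])@_m = if (a <= m)%MM then f@_(m - a) else 0.
Proof.
case: ifP => [am|nam]; first by rewrite -{1}(submK am) addmC mcoeffMX.
apply: memN_msupp_eq0; apply/negP => /msuppM_le /allpairsP [[m1 m2] /= [_ h e]].
by move: nam; rewrite e; move/mem_msuppXP: h => <-; rewrite lem_addl.
Qed.

Lemma retract_pureX u i : retract (u * 'X_i ^+ d) = retract u * 'X_i ^+ d.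
Proof.
rewrite mpolyXn; apply/mpolyP => m.
rewrite mcoeff_retract !mcoeffMX_sub mcoeff_retract.
case: (boolP (pure i <= m)%MM) => [im|_]; last by case: ifP.
rewrite -{1}(submK im); case: asboolP => [/powers_cancel/asboolT -> //|np].
by case: asboolP => // /powers_cancel.
Qed.

Lemma retract_pure u (g : {poly K}) i :
  retract (u * (map_poly (@mpolyC n K) g).['X_i ^+ d]) =
  retract u * (map_poly (@mpolyC n K) g).['X_i ^+ d].
Proof.
elim/poly_ind: g u => [|g c IHg] u; first by rewrite rmorph0 horner0 !mulr0 retract0.
rewrite rmorphD rmorphM /= map_polyX map_polyC /= hornerMXaddC !mulrDr.
rewrite retractD; congr (_ + _); last first.
  apply/mpolyP => m; rewrite mcoeff_retract ![_ * c%:MP]mulrC !mcoeffCM mcoeff_retract.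
  by case: ifP; rewrite ?mulr0.
by rewrite !mulrA retract_pureX IHg.
Qed.

Variables (s : seq 'X_{1..n}) (A : comNzRingType).
Variables (phi : {rmorphism K -> A}) (f : {rmorphism A -> S}).
Hypotheses (MsE : M = [set` s]) (f_inj : injective f).
Hypothesis f_const : forall c, f (phi c) = c%:MP.
Hypothesis f_image : forall g,
  (exists x, f x = g) <-> (forall m, m \in msupp g -> powers m).

Let lift_mon a : M a -> exists x, f x = 'X_[a].
Proof.
move=> Ma; apply/f_image => m /mem_msuppXP <-; exists 1%N; exact: mpow1.
Qed.

(** Repetitions in [t] are allowed, so that any chosen generator can be placed
    last, where [maximal_ideal_algebraic] reads it. *)
Lemma algebra_generated (t : seq 'X_{1..n}) : {subset s <= t} -> [set` t] `<=` M ->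
  exists y : nat -> A, (forall j, (j < size t)%N -> f (y j) = 'X_[nth 0%MM t j]) /\
    forall x, exists q, teval phi (size t) y q = x.
Proof.
move=> st tM.
have /choice [y yE] : forall j, exists x, (j < size t)%N -> f x = 'X_[nth 0%MM t j].
  move=> j; have [jt|] := boolP (j < size t)%N; last by exists 0.
  by have [|x xE] := @lift_mon (nth 0%MM t j); [apply: tM; apply: mem_nth|exists x].
exists y; split=> //; pose T := teval phi (size t) y.
suff h g : (forall m, m \in msupp g -> powers m) -> exists q, f (T q) = g.
  by move=> x; have [|q /f_inj <-] := h (f x); [apply/f_image; exists x|exists q].
move=> hg; suff hX m : powers m -> exists q, f (T q) = 'X_[m].
  suff hr (r : seq 'X_{1..n}) : {subset r <= msupp g} ->
      exists q, f (T q) = \sum_(m <- r) g@_m *: 'X_[m].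
    by have [q qE] := hr (msupp g) (fun _ => id); exists q; rewrite qE -mpolyE.
  elim: r => [|m r IHr] rg; first by exists 0; rewrite !rmorph0 big_nil.
  have [|q qE] := IHr; first by move=> m' m'r; apply: rg; rewrite inE m'r orbT.
  have [|q' q'E] := hX m; first by apply/hg/rg; rewrite inE eqxx.
  have [c cE] := teval_const phi (size t) y (g@_m).
  exists (c * q' + q); rewrite 2!rmorphD 2!rmorphM q'E qE big_cons.
  by rewrite /T cE f_const mul_mpolyC.
move=> [k]; elim: k m => [|k IHk] m /=.
  by move=> ->; exists 1; rewrite !rmorph1 mpolyX0.
move=> [b [m' [Mb /IHk [q qE] ->]]].
have bt : b \in t by apply: st; move: Mb; rewrite MsE.
have [|q' q'E] := @teval_var _ _ phi (size t) y (index b t); first by rewrite index_mem.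
exists (q' * q); rewrite 2!rmorphM qE mpolyXD; congr (_ * _).
by rewrite /T q'E yE ?index_mem // nth_index.
Qed.

(** Multiplication by a polynomial in a pure power commutes with the
    retraction onto the algebra, so a relation in the ambient polynomial ring
    retracts to a relation in the algebra. *)
Lemma pure_power_regular (g : 'I_n -> {poly K}) (z : 'I_n -> A) :
    (forall i, g i \is monic) ->
    (forall i, f (z i) = (map_poly (@mpolyC n K) (g i)).['X_i ^+ d]) ->
  forall (r : seq 'I_n) i x, i \notin r ->
    ideal_gen [set` map z r] (z i * x) -> ideal_gen [set` map z r] x.
Proof.
move=> g_monic zE r i x ir.
pose h i := g i \Po 'X^d.
have h_monic j : h j \is monic.
  rewrite monicE lead_coef_comp ?size_polyXn // lead_coefXn expr1n mulr1.
  exact: g_monic.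
have zE' j : f (z j) = in_var j (h j).
  by rewrite zE /in_var /h map_comp_poly horner_comp map_polyXn hornerXn.
move=> /ideal_gen_sumP [c cE].
have : ideal_gen [set` [seq in_var j (h j) | j <- r]] (f x).
  apply: (univariate_regular h_monic ir); rewrite -zE' -rmorphM cE rmorph_sum.
  apply: ideal_bigsum; first exact: ideal_gen_is_ideal.
  move=> j _; rewrite rmorphM; apply: (idealM (ideal_gen_is_ideal _)).
  apply: ideal_gen_sub => /=.
  have jr : (j < size r)%N by rewrite -(size_map z) ltn_ord.
  by rewrite (nth_map i) // zE'; apply: (map_f (fun k => in_var k (h k)));
    apply: mem_nth.
move=> /ideal_gen_sumP [u uE].
have /choice [v vE] : forall j, exists v, f v = retract (u j).
  by move=> j; apply/f_image => m; apply: retract_supp.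
suff -> : x = \sum_(j < size (map z r)) v j * (map z r)`_j by apply: ideal_gen_sum.
apply: f_inj; rewrite rmorph_sum -[LHS]retract_id; last by apply/f_image; exists x.
rewrite uE (big_morph _ retractD retract0) !size_map; apply: eq_bigr => j _.
by rewrite !(nth_map i) // rmorphM vE -zE' zE retract_pure.
Qed.

(** Zariski's lemma puts a monic polynomial in each of the pure powers into a
    given maximal ideal; these [n] elements form a regular sequence, and [n]
    also bounds the lengths of chains of primes. *)
Lemma pure_power_cohen_macaulay : cohen_macaulay A.
Proof.
split.
  have [||y [_ surj]] := @algebra_generated s; [by []|by rewrite MsE|].
  exact: (noetherian_surj surj (@tower_noetherian K _)).
move=> P P_prime P_max; exists n.
have /choice [z zP] : forall i, exists z, P z /\ exists2 g : {poly K}, g \is monic &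
    f z = (map_poly (@mpolyC n K) g).['X_i ^+ d].
  move=> i; have [||y [yE surj]] := @algebra_generated (rcons s (pure i)).
  - by move=> a sa; rewrite mem_rcons inE sa orbT.
  - move=> a /=; rewrite mem_rcons inE => /orP [/eqP -> //|].
    by rewrite MsE.
  rewrite size_rcons in yE surj.
  have [g g_monic Pg] := maximal_ideal_algebraic P_max surj.
  exists (map_poly phi g).[y (size s)]; split=> //; exists g => //.
  rewrite -horner_map -map_poly_comp yE // nth_rcons ltnn eqxx mpolyXn.
  by congr (_.[_]); apply: eq_map_poly => c /=; rewrite f_const.
have /choice [g gP] : forall i, exists g : {poly K}, g \is monic /\
    f (z i) = (map_poly (@mpolyC n K) g).['X_i ^+ d].
  by move=> i; have [_ [g gm zE]] := zP i; exists g.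
apply: (@localization_depth_dim _ _ P_prime (map z (enum 'I_n))).
- by move=> C j; apply: (embedded_chain_le f_inj f_const).
- by rewrite size_map size_enum_ord.
- by move=> _ /= /mapP [i _ ->]; case: (zP i).
- rewrite size_map size_enum_ord => k kn x; pose i := Ordinal kn.
  rewrite -map_take (nth_map i) ?size_enum_ord // (nth_ord_enum i i).
  apply: (pure_power_regular (g := g)) => [j|j|]; try by case: (gP j).
  by rewrite in_take ?mem_enum // index_enum_ord ltnn.
Qed.

End PurePowerReduction.

Lemma lift_constants (K : fieldType) n (A : comNzRingType)
    (f : {rmorphism A -> {mpoly K[n]}}) : injective f ->
    (forall c, exists x, f x = c%:MP) ->
  exists phi : {rmorphism K -> A}, forall c, f (phi c) = c%:MP.
Proof.
move=> f_inj /choice [phi phiE].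
have phiB : zmod_morphism phi.
  by move=> a b; apply: f_inj; rewrite rmorphB !phiE mpolyCB.
have phiM : monoid_morphism phi.
  by split=> [|a b]; apply: f_inj; rewrite ?rmorph1 ?rmorphM !phiE ?mpolyCM.
by exists (HB.pack_for {rmorphism K -> A} phi
  (GRing.isZmodMorphism.Build K A phi phiB)
  (GRing.isMonoidMorphism.Build K A phi phiM)).
Qed.

(** * Counting the products with pure powers *)

Section Counting.
Variables (n d : nat) (s : seq 'X_{1..n}).
Hypotheses (d_gt0 : (0 < d)%N) (s_uniq : uniq s).
Hypothesis s_deg : forall a, a \in s -> mdeg a = d.
Local Notation pure i := (U_(i) *+ d)%MM.
Hypothesis s_pure : forall i : 'I_n, pure i \in s.

Definition sums (t : seq 'X_{1..n}) := undup [seq (a + b)%MM | a <- t, b <- s].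

Definition pures : seq 'X_{1..n} := [seq pure i | i <- enum 'I_n].

Let pure_inj : injective (fun i : 'I_n => pure i).
Proof.
move=> i j /(congr1 (fun u : 'X_{1..n} => u i)); rewrite !mulmnE !mnm1E eqxx.
by case: eqP => [-> //|_]; lia.
Qed.

Lemma pure_absorbs i a : a \in s -> (d <= a i)%N -> a = pure i.
Proof.
move=> sa da; apply/esym/lem_mdeg_eq; last by rewrite mdegMn mdeg1 mul1n s_deg.
by apply/mnm_lepP => j; rewrite mulmnE mnm1E; case: eqP => [<-|]; lia.
Qed.

Let repeated (i : 'I_n) a := [exists j : 'I_n, (j < i)%N && (a == pure j)].

(** Two products of a pure power and an element of [s] agree only when they
    are [pure i + pure j] and [pure j + pure i]: if [pure i + a = pure j + b]
    with [i <> j], then [pure j] divides [a], and it has the same degree. So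
    exactly ['C(n, 2)] of the [n * size s] products are repetitions. *)
Lemma size_pure_sums : (size (sums pures) + 'C(n, 2) = n * size s)%N.
Proof.
pose L := [seq (i, a) | i <- enum 'I_n, a <- s].
pose bad (x : 'I_n * 'X_{1..n}) := repeated x.1 x.2.
pose prod_of (x : 'I_n * 'X_{1..n}) := (pure x.1 + x.2)%MM.
have uL : uniq L.
  by apply: allpairs_uniq => //; [apply: enum_uniq|move=> [i a] [j b] _ _ [-> ->]].
have LP i a : ((i, a) \in L) = (a \in s).
  apply/allpairsP/idP => [[[j b] /= [_ sb [_ ->]]] //|sa].
  by exists (i, a); rewrite mem_enum.
have sub_dg i j a b : i != j -> a \in s -> (pure i + a = pure j + b)%MM -> a = pure j.
  move=> ij sa /(congr1 (fun u : 'X_{1..n} => u j)).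
  rewrite !mnmDE !mulmnE !mnm1E eqxx (negbTE ij) => e.
  by apply: pure_absorbs => //; lia.
have badP (i : 'I_n) a :
    reflect (exists2 j : 'I_n, (j < i)%N & a = pure j) (bad (i, a)).
  rewrite /bad /repeated /=.
  apply: (iffP existsP) => [[j /andP [ji /eqP ->]]|[j ji ->]]; exists j => //.
  by rewrite ji eqxx.
have inj : {in filter (predC bad) L &, injective prod_of}.
  move=> [i a] [j b]; rewrite !mem_filter !LP /prod_of /=.
  move=> /andP [/badP ga sa] /andP [/badP gb sb] /= e.
  have [ij|ij] := eqVneq i j; first by move: e; rewrite ij => /addmI ->.
  have aE := sub_dg _ _ _ _ ij sa e; have ji : j != i by rewrite eq_sym.
  have bE := sub_dg _ _ _ _ ji sb (esym e).
  exfalso; case: (ltngtP i j) => [lt|lt|/val_inj eij].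
  - by apply: gb; exists i.
  - by apply: ga; exists j.
  - by rewrite eij eqxx in ij.
have -> : size (sums pures) = size (filter (predC bad) L).
  rewrite -[RHS](size_map prod_of); apply: perm_size; apply: uniq_perm.
  - exact: undup_uniq.
  - by rewrite (map_inj_in_uniq inj) filter_uniq.
  move=> m; rewrite mem_undup; apply/allpairsP/mapP.
  - move=> [[_ a] /= [/mapP [i _ ->] sa ->]].
    have [/badP [j ji aE]|good] := boolP (bad (i, a)); last first.
      by exists (i, a) => //; rewrite mem_filter LP sa andbT.
    exists (j, pure i); last by rewrite /prod_of /= aE addmC.
    rewrite mem_filter LP s_pure andbT; apply/badP => -[k kj /pure_inj ki].
    by move: ji kj; rewrite -ki; lia.
  - move=> [[i a]]; rewrite mem_filter LP => /andP [_ sa] ->.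
    by exists (pure i, a); split=> //; apply: map_f; rewrite mem_enum.
rewrite size_filter.
have -> : 'C(n, 2) = count bad L.
  rewrite -bin2_sum big_mkord count_flatten sumnE !big_map.
  rewrite -big_enum enumT /=; apply: eq_bigr => i _; rewrite count_map.
  have <- : size [seq pure j | j : 'I_n <- enum 'I_n & (j < i)%N] = i.
    rewrite size_map size_filter -(count_map val (fun k => k < i)%N) val_enum_ord.
    rewrite -sum1_count -[iota 0 n]/(iota 0 n) -[n in iota _ n]subn0.
    rewrite -/(index_iota 0 n) big_mkord.
    rewrite (big_ord_narrow_cond (ltnW (ltn_ord i)) (P := predT)) /=.
    by rewrite sum1_card card_ord.
  rewrite -size_filter; apply: perm_size; apply: uniq_perm.
  - by rewrite map_inj_uniq // filter_uniq // enum_uniq.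
  - exact: filter_uniq.
  move=> a; rewrite mem_filter /=; apply/mapP/andP => [[j]|[/badP [j ji ->] _]].
    by rewrite mem_filter => /andP [ji _] ->; split=> //; apply/badP; exists j.
  by exists j; rewrite // mem_filter ji mem_enum.
by rewrite addnC count_predC size_allpairs size_enum_ord.
Qed.

Lemma mem_sums (t : seq 'X_{1..n}) m :
  m \in sums t <-> madd [set` t] [set` s] m.
Proof.
rewrite mem_undup; split=> [/allpairsP [[a b] /= [ta sb ->]]|[a [b [ta sb ->]]]].
  by exists a, b.
by apply/allpairsP; exists (a, b).
Qed.

Lemma sums_pures_sub : {subset sums pures <= sums s}.
Proof.
move=> m /mem_sums [a [b [pa sb ->]]]; apply/mem_sums; exists a, b; split=> //.
by move: pa => /= /mapP [i _ ->].
Qed.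

End Counting.

(** * Freiman ideals *)

Section Freiman.
Variables (K : fieldType) (n d : nat) (s : seq 'X_{1..n}).
Local Notation S := {mpoly K[n]}.
Local Notation pure i := (U_(i) *+ d)%MM.
Hypotheses (d_gt0 : (0 < d)%N) (s_uniq : uniq s).
Hypothesis s_deg : forall a, a \in s -> mdeg a = d.
Hypothesis s_pure : forall i : 'I_n, pure i \in s.
Let I : set S := monideal [set` s].
Let J : set S := ideal_gen [set ('X_i : S) ^+ d | i in [set: 'I_n]].

Let sums_deg t m : (forall a, a \in t -> mdeg a = d) ->
  m \in sums s t -> mdeg m = (d + d)%N.
Proof.
move=> td /mem_sums [a [b [/= ta sb ->]]]; by rewrite mdegD td // s_deg.
Qed.

Let square_eq : ideal_pow I 2 = monideal [set` sums s s].
Proof.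
rewrite /I monideal_pow /=; congr monideal; apply/seteqP; split=> m /=.
  move=> [a [_ [sa [b [_ [sb -> ->]]] ->]]]; apply/mem_sums.
  by exists a, b; rewrite addm0.
move=> /mem_sums [a [b [sa sb ->]]]; exists a, b; split=> //.
by exists b, 0%MM; rewrite addm0.
Qed.

Let product_eq : ideal_mul J I = monideal [set` sums s (pures n d)].
Proof.
have -> : J = monideal [set` pures n d].
  congr ideal_gen; apply/seteqP; split=> [_ [i _ <-]|_ [_ /= /mapP [i _ ->] <-]].
    by exists (pure i); rewrite ?mpolyXn //=; apply: map_f; rewrite mem_enum.
  by exists i; rewrite // mpolyXn.
rewrite monideal_mul; congr monideal; apply/seteqP; split=> m; by move/mem_sums.
Qed.

Lemma reduction_iff_size :
  ideal_pow I 2 = ideal_mul J I <-> size (sums s s) = size (sums s (pures n d)).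
Proof.
have pures_deg a : a \in pures n d -> mdeg a = d.
  by move=> /mapP [i _ ->]; rewrite mdegMn mdeg1 mul1n.
have sub := @sums_pures_sub n d s s_pure.
rewrite square_eq product_eq; split=> [e|e].
  apply/eqP; rewrite eqn_leq; apply/andP; split.
    apply: uniq_leq_size; first exact: undup_uniq.
    move=> m ms; apply: (@monideal_mdeg_eq K n [set` sums s (pures n d)] (d + d)).
    - by move=> a /= ; apply: sums_deg pures_deg.
    - exact: sums_deg ms.
    - by rewrite -e; apply: ideal_gen_sub; exists m.
  by apply: uniq_leq_size; first exact: undup_uniq.
have [_ eqm] := uniq_min_size (undup_uniq _) sub (eq_leq e).
by congr monideal; apply/seteqP; split=> m /=; rewrite eqm.
Qed.

Lemma reduction_exchange : ideal_pow I 2 = ideal_mul J I ->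
  forall a b, a \in s -> b \in s ->
    exists i c, c \in s /\ (a + b = pure i + c)%MM.
Proof.
have sub := @sums_pures_sub n d s s_pure.
move=> /reduction_iff_size e a b sa sb.
have [_ eqm] := uniq_min_size (undup_uniq _) sub (eq_leq e).
have : (a + b)%MM \in sums s (pures n d) by rewrite eqm; apply/mem_sums; exists a, b.
move=> /mem_sums [_ [c [/= /mapP [i _ ->] sc abE]]].
by exists i, c.
Qed.

Let M_deg a : [set` s] a -> mdeg a = d. Proof. exact: s_deg. Qed.

Let fiber_cone_facts : exists (f : {rmorphism fiber_cone I -> S})
    (phi : {rmorphism K -> fiber_cone I}),
  [/\ injective f, forall c, f (phi c) = c%:MP &
      forall g, (exists x, f x = g) <->
        (forall m, m \in msupp g -> powers [set` s] m)].
Proof.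
have [f [f_inj f_image]] := fiber_cone_embedding K d_gt0 M_deg.
have [|phi phiE] := lift_constants f_inj; last by exists f, phi.
move=> c; apply/f_image => m; rewrite msuppC; case: ifP => // _.
by rewrite inE => /eqP ->; exists 0%N.
Qed.

Lemma fiber_cone_dim : krull_dim (fiber_cone I) n.
Proof.
have [f [phi [f_inj phiE f_image]]] := fiber_cone_facts.
apply: (embedded_krull_dim f_inj phiE d_gt0) => i.
apply/f_image => m; rewrite mpolyXn => /mem_msuppXP <-.
by exists 1%N; apply: mpow1; apply: s_pure.
Qed.

(** With the analytic spread equal to [n], the Freiman equation says that [I^2]
    has as many minimal generators as [J I]. *)
Lemma freiman_iff_reduction : freiman I <-> ideal_pow I 2 = ideal_mul J I.
Proof.
have mu_I := mu_monideal K s_uniq s_deg.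
have mu_I2 : mu (ideal_pow I 2) (size (sums s s)).
  rewrite square_eq; apply: (mu_monideal K (undup_uniq _) (d := (d + d)%N)) => a.
  exact: sums_deg.
have count := size_pure_sums d_gt0 s_uniq s_deg s_pure.
rewrite reduction_iff_size; split=> [[m [m2 [l [hm hm2 hl e]]]]|e].
  move: e; rewrite (mu_unique hm mu_I) (mu_unique hm2 mu_I2).
  rewrite (is_max_unique hl fiber_cone_dim); lia.
exists (size s), (size (sums s s)), n; split=> //; first exact: fiber_cone_dim.
lia.
Qed.

Lemma freiman_cohen_macaulay : freiman I -> cohen_macaulay (fiber_cone I).
Proof.
move=> /freiman_iff_reduction red.
have [f [phi [f_inj phiE f_image]]] := fiber_cone_facts.
exact: (@pure_power_cohen_macaulay K n d [set` s] d_gt0 M_deg s_pure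
  (reduction_exchange red) s _ phi f).
Qed.

End Freiman.

Theorem theorem2p1 (K : fieldType) (n d : nat) (I : set {mpoly K[n]})
  (I_monomial : monomial_ideal I) (I_equigenerated : equigenerated I d)
  (I_height : height I n) :
  let J := ideal_gen [set ('X_i : {mpoly K[n]}) ^+ d | i in [set: 'I_n]] in
  (freiman I <-> ideal_pow I 2 = ideal_mul J I) /\
  (freiman I -> cohen_macaulay (fiber_cone I)).
Proof.
have [s [s_uniq s_deg IE]] := equigenerated_monideal I_monomial I_equigenerated.
subst I; have s_pure i := @height_pure_power K n s d i s_deg I_height.
have no0 : 0%MM \notin s.
  apply/negP => s0; case: I_height => -[P [[idP P1 _] IP _]] _; apply: P1.
  by apply: IP; rewrite -mpolyX0; apply: ideal_gen_sub; exists 0%MM.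
case: (posnP n) => [n0|n_gt0]; last first.
  have d_gt0 : (0 < d)%N.
    rewrite lt0n; apply: contraNneq no0 => d0.
    by have := s_pure (Ordinal n_gt0); rewrite d0 mulm0n.
  split; first exact: (freiman_iff_reduction K d_gt0 s_uniq s_deg s_pure).
  exact: (freiman_cohen_macaulay d_gt0 s_uniq s_deg s_pure).
(* Without variables the ideal is zero, and [d = 1] may be assumed. *)
subst n; have s_nil a : a \in s = false.
  by rewrite [a](_ : _ = 0%MM) ?(negbTE no0) //; apply/mnmP; case.
have pure1 (i : 'I_0) : (U_(i) *+ 1)%MM \in s by case: i.
have deg1 a : a \in s -> mdeg a = 1%N by rewrite s_nil.
have -> : [set ('X_i : {mpoly K[0]}) ^+ d | i in [set: 'I_0]] =
    [set ('X_i : {mpoly K[0]}) ^+ 1 | i in [set: 'I_0]].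
  have no_var : 'I_0 -> False by case.
  by apply/seteqP; split=> f [i]; case: (no_var i).
split; first exact: (freiman_iff_reduction K (ltn0Sn 0) s_uniq deg1 pure1).
exact: (freiman_cohen_macaulay (ltn0Sn 0) s_uniq deg1 pure1).
Qed.
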